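(* Let $G$ be a locally finite graph, $T$ a faithful spanning tree of $G$, and $F\subseteq E(T)$ such that every component of $T-F$ is finite. Suppose that for every finite subtree $T'$ of $T$, $G$ has a cycle $C'$ such that (1) $V(T')\subseteq V(C')$, and (2) $C'$ crosses each edge in $F\cap E(T')$ exactly twice with respect to $T$. Then $G$ has a Hamiltonian circle.
   Context: A ray is a one-way infinite path; its subrays are tails. Two rays $R_1,R_2$ of a graph $X$ are equivalent in $X$ ($R_1\approx_X R_2$) if for every finite $S\subseteq V(X)$ some component of $X-S$ contains tails of both; the classes are the ends of $X$. A subgraph $H$ of $G$ is faithful to $G$ if (1) every end of $G$ contains a ray of $H$, and (2) for any two rays $R_1,R_2$ of $H$, $R_1\approx_H R_2$ iff $R_1\approx_G R_2$. For disjoint $A,B\subseteq V(G)$, a nontrivial path $P=v_0\dots v_p$ is an $(A,B)$-path if $V(P)\cap A=\{v_0\}$, $V(P)\cap B=\{v_p\}$. For a cycle $C$, an edge $e\in E(T)$, and $T_1,T_2$ the two components of $T-e$, $C$ crosses $e$ exactly $k$ times with respect to $T$ if $C$ contains exactly $k$ $(V(T_1),V(T_2))$-paths. The Freudenthal compactification $|G|$ is $G$ as a 1-complex plus its ends, where a basic neighbourhood of an end $\alpha$ is $C(S,\alpha)\cup\Omega(S,\alpha)\cup E(S,\alpha)$ for finite $S$ ($C(S,\alpha)$ the component of $G-S$ containing tails of rays of $\alpha$, $\Omega(S,\alpha)$ the ends with the same component, $E(S,\alpha)$ inner points of edges between $S$ and $C(S,\alpha)$). A Hamiltonian circle is a homeomorphic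 image of $S^1$ in $|G|$ containing every vertex of $G$. *)

(* Defs.v *)
From HB Require Import structures.
From mathcomp Require Import all_boot all_order all_algebra.
From mathcomp Require Import all_classical all_reals all_analysis.
Import Order.TTheory GRing.Theory Num.Theory numFieldNormedType.Exports.

Set Implicit Arguments.
Unset Strict Implicit.
Unset Printing Implicit Defensive.

Local Open Scope classical_set_scope.
Local Open Scope ring_scope.

(* Simple graphs, finite or infinite, whose vertices form a subset of a fixed
   type; a graph and its subgraphs thus all have type [graph V]. *)
Record graph (V : choiceType) := Graph {
  verts : set V ;
  adj : rel V ;
  adj_sym : symmetric adj ;
  adj_irr : irreflexive adj ;
  adj_verts : forall x y, adj x y -> verts x }.

Definition edges (V : choiceType) (G : graph V) : set (set V) :=
  [set e | exists x y, adj G x y /\ e = [set x; y]].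

Definition locally_finite (V : choiceType) (G : graph V) : Prop :=
  forall v, verts G v -> finite_set [set w | adj G v w].

Definition subgraph (V : choiceType) (H G : graph V) : Prop :=
  verts H `<=` verts G /\ (forall x y, adj H x y -> adj G x y).

Definition spanning (V : choiceType) (H G : graph V) : Prop :=
  subgraph H G /\ verts H = verts G.

Section SubgraphConstructions.
Context (V : choiceType) (G : graph V).

Section Induced.
Context (D : set V).
Let a := fun x y : V => [&& adj G x y, x \in D & y \in D].
Fact induced_sym : symmetric a.
Proof. by move=> x y; rewrite /a adj_sym [_ && (y \in D)]andbC. Qed.
Fact induced_irr : irreflexive a.
Proof. by move=> x; rewrite /a adj_irr. Qed.
Fact induced_verts x y : a x y -> (verts G `&` D) x.
Proof. by case/and3P => /adj_verts Gx /set_mem Dx _. Qed.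
Definition induced : graph V := Graph induced_sym induced_irr induced_verts.
End Induced.

Definition del_verts (S : set V) : graph V := induced (~` S).

Section DelEdges.
Context (F : set (set V)).
Let a := fun x y : V => adj G x y && ([set x; y] \notin F).
Fact del_edges_sym : symmetric a.
Proof. by move=> x y; rewrite /a adj_sym setUC. Qed.
Fact del_edges_irr : irreflexive a.
Proof. by move=> x; rewrite /a adj_irr. Qed.
Fact del_edges_verts x y : a x y -> verts G x.
Proof. by case/andP => /adj_verts. Qed.
Definition del_edges : graph V :=
  Graph del_edges_sym del_edges_irr del_edges_verts.
End DelEdges.

End SubgraphConstructions.

Definition linked (V : choiceType) (G : graph V) (x y : V) : Prop :=
  verts G x /\ exists2 p : seq V, path (adj G) x p & y = last x p.

(* Components are given by their vertex sets. *)
Definition components (V : choiceType) (G : graph V) : set (set V) :=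
  [set D | exists2 x, verts G x & D = [set y | linked G x y]].

Definition graph_connected (V : choiceType) (G : graph V) : Prop :=
  verts G !=set0 /\ (forall x y, verts G x -> verts G y -> linked G x y).

Definition is_cycle (V : choiceType) (C : graph V) : Prop :=
  exists c : seq V, [/\ uniq c, (3 <= size c)%N, verts C = [set` c] &
    forall x y, adj C x y =
      [&& x \in c, y \in c & (y == next c x) || (x == next c y)]].

Definition acyclic (V : choiceType) (G : graph V) : Prop :=
  ~ exists C : graph V, subgraph C G /\ is_cycle C.

Definition is_tree (V : choiceType) (T : graph V) : Prop :=
  graph_connected T /\ acyclic T.

(* The (A,B)-paths v_0 ... v_p contained in H.  For disjoint A and B, a path
   subgraph is listed exactly once, since v_0 is its endvertex in A. *)
Definition AB_paths (V : choiceType) (H : graph V) (A B : set V) :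
    set (seq V) :=
  [set s | exists x q,
    [/\ s = x :: q, q <> [::], uniq s & path (adj H) x q] /\
    [set` s] `&` A = [set x] /\ [set` s] `&` B = [set last x q]].

Definition crosses (V : choiceType) (C T : graph V) (e : set V) (k : nat) :
    Prop :=
  exists T1 T2 : set V, [/\ components (del_edges T [set e]) = [set T1; T2],
    T1 <> T2 & (AB_paths C T1 T2 #= `I_k)%card].

Definition ray (V : choiceType) (G : graph V) (r : nat -> V) : Prop :=
  injective r /\ forall n, adj G (r n) (r n.+1).

Definition has_tail (V : choiceType) (D : set V) (r : nat -> V) : Prop :=
  exists n, forall k, (n <= k)%N -> D (r k).

Definition ray_equiv (V : choiceType) (G : graph V) (r1 r2 : nat -> V) : Prop :=
  forall S : set V, finite_set S -> S `<=` verts G ->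
    exists2 D, components (del_verts G S) D & has_tail D r1 /\ has_tail D r2.

Definition ends (V : choiceType) (G : graph V) : set (set (nat -> V)) :=
  [set a | exists2 r, ray G r & a = [set r' | ray G r' /\ ray_equiv G r r']].

Definition faithful (V : choiceType) (H G : graph V) : Prop :=
  (forall a, ends G a -> exists2 r, ray H r & a r) /\
  (forall r1 r2, ray H r1 -> ray H r2 ->
     (ray_equiv H r1 r2 <-> ray_equiv G r1 r2)).

(* The 1-complex of G, in barycentric coordinates: a vertex v is the indicator
   function of v, and an edge xy is the segment between x and y. *)
Definition vertex_pt (R : realType) (V : choiceType) (v : V) : V -> R :=
  fun w => (w == v)%:R.

Definition edge_pt (R : realType) (V : choiceType) (x y : V) (t : R) : V -> R :=
  fun w => (1 - t) * (w == x)%:R + t * (w == y)%:R.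

Definition complex_pts (R : realType) (V : choiceType) (G : graph V) :
    set (V -> R) :=
  [set p | (exists2 v, verts G v & p = vertex_pt R v) \/
           (exists x y t, [/\ adj G x y, 0 < t < 1 & p = edge_pt x y t])].

Arguments complex_pts R {V} G _.

Inductive freudenthal (R : realType) (V : choiceType) (G : graph V) : Type :=
| ComplexPt of set_type (complex_pts R G)
| EndPt of set_type (ends G).

HB.instance Definition _ (R : realType) (V : choiceType) (G : graph V) :=
  gen_eqMixin (freudenthal R G).
HB.instance Definition _ (R : realType) (V : choiceType) (G : graph V) :=
  gen_choiceMixin (freudenthal R G).

(* C(S, a); the union is over a single component. *)
Definition end_comp (V : choiceType) (G : graph V) (S : set V)
    (a : set (nat -> V)) : set V :=
  \bigcup_(D in [set D | components (del_verts G S) D /\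
                         (forall r, a r -> has_tail D r)]) D.

(* Inner points of the edges of G between S and D. *)
Definition cut_pts (R : realType) (V : choiceType) (G : graph V)
    (S D : set V) : set (V -> R) :=
  [set p | exists x y t,
    [/\ adj G x y, S x, D y & 0 < t < 1 /\ p = edge_pt x y t]].

Arguments cut_pts R {V} G S D _.

Definition end_nbhd (R : realType) (V : choiceType) (G : graph V)
    (S : set V) (a : set (nat -> V)) : set (freudenthal R G) :=
  [set p | match p with
    | ComplexPt x => complex_pts R (induced G (end_comp G S a)) (\val x) \/
                     cut_pts R G S (end_comp G S a) (\val x)
    | EndPt b => end_comp G S (\val b) = end_comp G S a
    end].

Definition edge_trace (R : realType) (V : choiceType) (G : graph V)
    (O : set (freudenthal R G)) (x y : V) : set R :=
  [set t | exists2 p : set_type (complex_pts R G),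
             \val p = edge_pt x y t & O (ComplexPt p)].

Arguments end_nbhd R {V} G S a _.

(* On the 1-complex this is the weak topology: a set is open iff its trace on
   every closed edge is open in that edge, parametrised by [0, 1]. *)
Definition freudenthal_open (R : realType) (V : choiceType) (G : graph V)
    (O : set (freudenthal R G)) : Prop :=
  (forall x y, adj G x y ->
     open (edge_trace O x y : set (subspace `[0, 1]))) /\
  (forall a : set_type (ends G), O (EndPt R a) ->
     exists S, [/\ finite_set S, S `<=` verts G &
                   end_nbhd R G S (\val a) `<=` O]).

Section FreudenthalTopology.
Context (R : realType) (V : choiceType) (G : graph V).
Implicit Types (S D : set V) (H : graph V).

Lemma linked_refl H x : verts H x -> linked H x x.
Proof. by move=> Hx; split=> //; exists [::]. Qed.

Lemma linked_trans H x y z : linked H x y -> linked H y z -> linked H x z.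
Proof.
move=> [Hx [p px ->]] [_ [q qy ->]]; split=> //; exists (p ++ q).
  by rewrite cat_path px.
by rewrite last_cat.
Qed.

Lemma linked_verts H x y : linked H x y -> verts H y.
Proof.
move=> [Hx [p px ->]]; elim: p x Hx px => //= z p IH x Hx /andP[xz zp].
by apply: IH => //; rewrite adj_sym in xz; exact: adj_verts xz.
Qed.

Lemma linked_sym H x y : linked H x y -> linked H y x.
Proof.
move=> xy; split; first exact: linked_verts xy.
case: xy => [Hx [p px ->]]; exists (rev (belast x p)).
  by rewrite rev_path (eq_path (e' := adj H)) // => a b; rewrite adj_sym.
by case: p {px} => //= a p; rewrite rev_cons last_rcons.
Qed.

Lemma linked_mono H H' x y : subgraph H H' -> linked H x y -> linked H' x y.
Proof.
move=> [sv sa] [Hx [p px ->]]; split; first exact: sv.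
by exists p => //; apply: sub_path px.
Qed.

Lemma del_verts_mono S S' : S `<=` S' ->
  subgraph (del_verts G S') (del_verts G S).
Proof.
move=> sS; split=> [x [Gx S'x]|x y /= /and3P[xy]]; first by split=> // /sS.
by rewrite !inE => S'x S'y; rewrite xy !mem_set //= => /sS.
Qed.

Lemma components_meet H D D' x : components H D -> components H D' ->
  D x -> D' x -> D = D'.
Proof.
move=> [u Hu ->] [v Hv ->] /= ux vx; apply/seteqP; split=> z /= h.
  exact: linked_trans vx (linked_trans (linked_sym ux) h).
exact: linked_trans ux (linked_trans (linked_sym vx) h).
Qed.

Lemma ray_avoid S (r : nat -> V) : finite_set S -> injective r ->
  exists n, forall k, (n <= k)%N -> ~ S (r k).
Proof.
move=> finS injr.
have : finite_set (r @^-1` S).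
  by apply: finite_preimage => // x y _ _; exact: injr.
move=> /finite_seqP[s sE]; exists (\max_(i <- s) i).+1 => k nk Sk.
have ks : k \in s by have : (r @^-1` S) k by []; rewrite sE.
have : (k <= \max_(i <- s) i)%N by apply: (@leq_bigmax_seq _ s xpredT id k).
by rewrite leqNgt nk.
Qed.

Lemma ray_equiv_refl r : ray G r -> ray_equiv G r r.
Proof.
move=> [injr adjr] S finS SG; have [n nS] := ray_avoid finS injr.
have Hv k : (n <= k)%N -> verts (del_verts G S) (r k).
  by move=> nk; split; [exact: adj_verts (adjr k)|exact: nS].
exists [set y | linked (del_verts G S) (r n) y].
  by exists (r n) => //; exact: Hv.
suff : has_tail [set y | linked (del_verts G S) (r n) y] r by [].
exists n => k /subnK <-; elim: (k - n)%N => [|m IH] /=.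
  exact: linked_refl (Hv _ _).
apply: linked_trans IH _; split; first exact: Hv (leq_addl _ _).
exists [:: r (m.+1 + n)%N] => //=.
rewrite addSn adjr /= !mem_set //; first by apply: nS; rewrite -addSn leq_addl.
exact/nS/leq_addl.
Qed.

Lemma has_tail_meet D D' (r : nat -> V) : has_tail D r -> has_tail D' r ->
  exists2 x, D x & D' x.
Proof.
move=> [n hn] [m hm]; exists (r (maxn n m)).
  exact/hn/leq_maxl.
exact/hm/leq_maxr.
Qed.

Lemma end_comp_exists S a : finite_set S -> S `<=` verts G -> ends G a ->
  exists2 D, components (del_verts G S) D & forall r, a r -> has_tail D r.
Proof.
move=> finS SG [r rG ->]; have [D DS [Dr _]] := ray_equiv_refl rG finS SG.
exists D => // r' [r'G /(_ _ finS SG)[D' D'S [D'r D'r']]].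
have [x Dx D'x] := has_tail_meet Dr D'r.
by rewrite (components_meet DS D'S Dx D'x).
Qed.

Lemma end_has_ray a : ends G a -> exists r, a r.
Proof. by move=> [r rG ->]; exists r; split=> //; exact: ray_equiv_refl. Qed.

Lemma end_compE S a D : ends G a -> components (del_verts G S) D ->
  (forall r, a r -> has_tail D r) -> end_comp G S a = D.
Proof.
move=> aG DS Da; apply/seteqP; split=> [x [D' [D'S D'a] D'x]|x Dx]; last first.
  by exists D.
have [r ar] := end_has_ray aG; have [y Dy D'y] := has_tail_meet (Da _ ar) (D'a _ ar).
by rewrite (components_meet DS D'S Dy D'y).
Qed.

Lemma components_nonempty H D : components H D -> D !=set0.
Proof. by move=> [x Hx ->]; exists x; exact: linked_refl. Qed.

Lemma components_sub S S' D' : S `<=` S' -> components (del_verts G S') D' ->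
  exists2 D, components (del_verts G S) D & D' `<=` D.
Proof.
move=> sS [x xS' ->]; have [sv _] := del_verts_mono sS.
exists [set y | linked (del_verts G S) x y]; first by exists x => //; exact: sv.
by move=> y; apply: linked_mono; exact: del_verts_mono.
Qed.

Lemma end_nbhd_mono S S' a : finite_set S' -> S' `<=` verts G -> S `<=` S' ->
  ends G a -> end_nbhd R G S' a `<=` end_nbhd R G S a.
Proof.
move=> finS' S'G sS aG.
have [D' D'S' D'a] := end_comp_exists finS' S'G aG.
have [D DS D'D] := components_sub sS D'S'.
have Da r : a r -> has_tail D r.
  by move=> /D'a[n h]; exists n => k /h /D'D.
have Ea' := end_compE aG D'S' D'a; have Ea := end_compE aG DS Da.
have Dv v : D v -> verts (del_verts G S) v.
  by case: DS => x _ ->; exact: linked_verts.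
move=> [[x xP]|[b bP]] /=; rewrite Ea' Ea; last first.
  have bG : ends G b by exact: set_mem bP.
  move=> bD'; have [B' B'S' B'b] := end_comp_exists finS' S'G bG.
  rewrite (end_compE bG B'S' B'b) in bD'; rewrite bD' in B'b.
  by apply: end_compE => // r /B'b[n h]; exists n => k /h /D'D.
case=> [[[v [Gv D'v] ->]|[u [v [t [/= /and3P[uv]]]]]]|].
- by left; left; exists v => //; split=> //; exact: D'D.
- rewrite !inE => D'u D'v t01 ->; left; right; exists u, v, t; split=> //=.
  by rewrite uv !mem_set //; exact: D'D.
move=> [u [v [t [uv S'u D'v [t01 ->]]]]].
have {}D'v := D'D _ D'v.
have [Su|nSu] := pselect (S u); first by right; exists u, v, t.
left; right; exists u, v, t; split=> //=; rewrite uv !mem_set //=.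
have [Gv nSv] := Dv _ D'v.
case: DS D'v => z Gz -> /= zv; apply: linked_trans zv _; split=> //.
by exists [:: u] => //=; rewrite adj_sym uv !mem_set.
Qed.

Lemma freudenthal_openT : freudenthal_open (@setT (freudenthal R G)).
Proof.
split=> [x y xy|a _]; last first.
  by exists set0; split=> //; exact: finite_set0.
apply/open_subspaceP; exists setT; first exact: openT.
rewrite setTI; apply/seteqP; split=> // t t01; split=> //.
have pt : complex_pts R G (edge_pt x y t).
  move: t01; rewrite /= in_itv /= => /andP[]; rewrite !le_eqVlt.
  move=> /predU1P[<- _|t0 /predU1P[->|t1]].
  - left; exists x; first exact: adj_verts xy.
    by apply/funext => w; rewrite /edge_pt subr0 mul1r mul0r addr0.
  - left; exists y; first by move: xy; rewrite adj_sym; exact: adj_verts.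
    by apply/funext => w; rewrite /edge_pt subrr mul1r mul0r add0r.
  - by right; exists x, y, t; rewrite t0 t1.
by exists (exist _ (edge_pt x y t) (mem_set pt)).
Qed.

Lemma freudenthal_openI : setI_closed (@freudenthal_open R V G).
Proof.
move=> A B [Ae An] [Be Bn]; split=> [x y xy|a [Aa Ba]].
  suff -> : edge_trace (A `&` B) x y = edge_trace A x y `&` edge_trace B x y.
    by apply: openI; [exact: Ae|exact: Be].
  apply/seteqP; split=> [t [p pE [Ap Bp]]|t [[p pE Ap] [q qE Bq]]].
    by split; exists p.
  have pq : p = q by apply: val_inj; rewrite pE qE.
  by exists p => //; split=> //; rewrite pq.
have [S [finS SG SA]] := An _ Aa; have [S' [finS' S'G S'B]] := Bn _ Ba.
have aG : ends G (\val a) by apply: set_mem; exact: (valP a).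
have finU : finite_set (S `|` S') by rewrite finite_setU.
have UG : S `|` S' `<=` verts G by rewrite subUset.
exists (S `|` S'); split=> // p pU; split.
  by apply: SA; apply: end_nbhd_mono pU => //; exact: subsetUl.
by apply: S'B; apply: end_nbhd_mono pU => //; exact: subsetUr.
Qed.

Lemma freudenthal_open_bigU (I : Type) (f : I -> set (freudenthal R G)) :
  (forall i, freudenthal_open (f i)) -> freudenthal_open (\bigcup_i f i).
Proof.
move=> fo; split=> [x y xy|a [i _ fia]]; last first.
  have [S [finS SG Sf]] := (fo i).2 _ fia.
  by exists S; split=> // p /Sf; exists i.
suff -> : edge_trace (\bigcup_i f i) x y = \bigcup_i edge_trace (f i) x y.
  by apply: bigcup_open => i _; exact: (fo i).1.
apply/seteqP; split=> [t [p pE [i _ fp]]|t [i _ [p pE fp]]].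
  by exists i => //; exists p.
by exists p => //; exists i.
Qed.

HB.instance Definition _ := isOpenTopological.Build (freudenthal R G)
  freudenthal_openT freudenthal_openI freudenthal_open_bigU.

End FreudenthalTopology.

Definition homeomorphic (X Y : topologicalType) (A : set X) (B : set Y) :
    Prop :=
  exists (f : X -> Y) (g : Y -> X),
    [/\ f @` A = B, {in A, cancel f g}, {within A, continuous f} &
        {within B, continuous g}].

Definition unit_circle (R : realType) : set (R * R) :=
  [set z | z.1 ^+ 2 + z.2 ^+ 2 = 1].

Definition hamiltonian_circle (R : realType) (V : choiceType) (G : graph V)
    (H : set (freudenthal R G)) : Prop :=
  homeomorphic (@unit_circle R) H /\
  (forall p : set_type (complex_pts R G), forall v,
     verts G v -> \val p = vertex_pt R v -> H (ComplexPt p)).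

(* Main.v *)
Require Import Defs.
From mathcomp Require Import all_boot all_order all_algebra.
From mathcomp Require Import all_classical all_reals all_analysis.
From mathcomp Require Import lra ring.
From mathcomp Require Import zify.
Import Order.TTheory GRing.Theory Num.Theory numFieldNormedType.Exports.
Local Open Scope classical_set_scope.

Set Implicit Arguments.
Unset Strict Implicit.
Unset Printing Implicit Defensive.

Local Open Scope ring_scope.

(** A limit of the edge sets alone would be a union of double rays with no record of how they are
    strung together at the ends; hence orders, not subgraphs, are sent to a limit. Cutting at [v0]
    matters because the part behind an edge of [T] never contains [v0]: two crossings then make it
    an interval of a linear order, not just an arc of a cycle. A first or last vertex of such an
    interval has its cyclic neighbour outside, so it is an end of one of the finitely many cut
    edges, and an ultrafilter makes its choice constant.

    Finiteness of the components of [T - F] forces every ray of [T] to use infinitely many edges of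
    [F]. This gives intervals arbitrarily deep along a ray, which yields continuity at its end and
    also shows that two uncovered points cannot share a ray: a vertex between them would lie behind
    edges of arbitrarily high level. Faithfulness is used a second time here, since rays with the
    same end of [G] must be equivalent in [T].

    No inverse map is built: circle and image are both quotients of the compact segment by the same
    identification. *)

(** Cut the given cycles at a common vertex [v0] and let them converge along an
ultrafilter on the finite vertex sets: their cyclic orders have as limit a
linear order on [V(G)], in which, by local finiteness, every vertex has an
immediate successor that is one of its neighbours (cyclically: the successor of
the last vertex is [v0]). The part of [T] behind an edge of [F] is crossed only
twice, so it is an interval of almost all of the cycles and hence of the limit
order; it has a first and a last vertex because faithfulness makes the
fundamental cuts of [T] finite. Give every edge [{x, succ x}] a length [w x] with
finite total [W] and lay the order out along [[0, W]]. A point of [[0, W]] that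
no edge covers is approached by vertices, and an ultrafilter of vertices
converging to it picks a ray of [T], hence an end. The map [[0, W] -> |G|] so
defined is continuous, since the intervals behind the edges of [F] on such a ray
are neighbourhoods of the point, and it identifies nothing but [0] with [W]. *)

(** * Circles as images of a segment *)

(** On the compact [K] the map [e] is closed, hence a quotient map onto its image, and continuity
    descends from [phi] to [f]. *)
Lemma compact_lift_continuous (X Y Z : topologicalType) (K : set X)
    (e : X -> Y) (phi : X -> Z) (f : Y -> Z) :
  compact K -> hausdorff_space Y ->
  {within K, continuous e} -> {within K, continuous phi} ->
  (forall x, K x -> f (e x) = phi x) -> {within e @` K, continuous f}.
Proof.
move=> cK hY ce cphi fe; apply/continuous_closedP => C Ccl.
apply/closed_subspaceP.
have /closed_subspaceP[U Ucl UE] : closed (phi @^-1` C : set (subspace K)).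
  by move/continuous_closedP : cphi; exact.
have cKU : compact (K `&` U) by exact: compact_closedI.
exists (e @` (K `&` U)).
  apply: compact_closed => //; apply: continuous_compact cKU.
  by apply: continuous_subspaceW ce => x [].
have UP x : K x -> U x <-> C (phi x).
  move=> Kx; split=> [Ux|Cx].
    by have [] : (phi @^-1` C `&` K) x by rewrite -UE.
  by have [] : (U `&` K) x by rewrite UE.
apply/seteqP; split=> y [].
  by move=> [x [Kx Ux] <-] eKx; split; last exact: eKx; have := (UP x Kx).1 Ux; rewrite -fe.
move=> + [x Kx xy]; rewrite -xy => fCx; have Cx : C (phi x) by rewrite -fe.
by split; [exists x => //; split=> //; exact/UP|exists x].
Qed.

(** Two maps with the same fibres exhibit their images as the same quotient of [K]; the lift lemma
    is used once in each direction. *)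
Lemma homeomorphic_of_compact (X Y Z : topologicalType) (K : set X)
    (e : X -> Y) (phi : X -> Z) :
  K !=set0 -> compact K -> hausdorff_space Y -> hausdorff_space Z ->
  {within K, continuous e} -> {within K, continuous phi} ->
  (forall x y, K x -> K y -> e x = e y <-> phi x = phi y) ->
  homeomorphic (e @` K) (phi @` K).
Proof.
move=> [x0 Kx0] cK hY hZ ce cphi eP.
pose f y := phi (xget x0 [set x | K x /\ e x = y]).
pose g z := e (xget x0 [set x | K x /\ phi x = z]).
have fe x : K x -> f (e x) = phi x.
  by move=> Kx; rewrite /f; case: xgetP => [y _ [Ky /eP->]//|/(_ x)[]].
have gphi x : K x -> g (phi x) = e x.
  by move=> Kx; rewrite /g; case: xgetP => [y _ [Ky /eP->]//|/(_ x)[]].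
exists f, g; split.
- rewrite image_comp; apply/seteqP; split=> z [x Kx <-].
    by exists x => //=; rewrite fe.
  by exists x => //=; rewrite fe.
- by move=> y /set_mem[x Kx <-]; rewrite fe // gphi.
- exact: (@compact_lift_continuous _ _ _ K e phi).
- exact: (@compact_lift_continuous _ _ _ K phi e).
Qed.

(** Half-angle formula: [sin (x / 2)] is positive strictly between 0 and two pi. *)
Lemma cos_eq1 (R : realType) (x : R) : `|x| <= pi *+ 2 -> cos x = 1 ->
  x = 0 \/ `|x| = pi *+ 2.
Proof.
wlog x0 : x / 0 <= x.
  move=> h; have [|x0] := leP 0 x; first exact: h.
  move=> xp cx; have := h (- x).
  rewrite oppr_ge0 normrN cosN ltW // => /(_ isT xp cx)[/eqP|->]; last by right.
  by rewrite oppr_eq0 => /eqP; left.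
rewrite ger0_norm // => x2 cx; move: x2; rewrite le_eqVlt => /predU1P[->|x2]; first by right.
left; apply/eqP; rewrite eq_le x0 andbT leNgt; apply/negP => xp.
have : 0 < sin (x / 2) by apply: sin_gt0_pi; have := pi_gt0 R; lra.
have : cos x = 1 - sin (x / 2) ^+ 2 *+ 2.
  have {1}-> : x = x / 2 + x / 2 by lra.
  by rewrite cosD -!expr2 cos2sin2; ring.
by rewrite cx => h /(exprn_gt0 2); lra.
Qed.

Lemma unit_circle_param (R : realType) (W : R) : 0 < W ->
  exists e : R -> R * R,
    [/\ continuous e, e @` `[0, W] = @unit_circle R, e 0 = e W &
        forall s s', 0 <= s <= W -> 0 <= s' <= W -> e s = e s' ->
          s = s' \/ `|s - s'| = W].
Proof.
move=> W0; pose k : R := pi *+ 2 / W.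
have p0 := pi_gt0 R.
have k0 : 0 < k by rewrite divr_gt0 // mulr2n; lra.
have kW : k * W = pi *+ 2 by rewrite /k mulfVK //; lra.
exists (fun s => (cos (k * s), sin (k * s))); split.
- have cc : continuous (fun s : R => cos (k * s)).
    move=> s; apply: (@continuous_comp _ _ _ ( *%R k) (@cos R)).
      exact: mulrl_continuous.
    exact: continuous_cos.
  have cs : continuous (fun s : R => sin (k * s)).
    move=> s; apply: (@continuous_comp _ _ _ ( *%R k) (@sin R)).
      exact: mulrl_continuous.
    exact: continuous_sin.
  by move=> s; exact: (cvg_pair (cc s) (cs s)).
- apply/seteqP; split=> [_ [s _ <-]|[x y]]; first by rewrite /unit_circle /= cos2Dsin2.
  rewrite /unit_circle /= => xy.
  have x1 : -1 <= x <= 1.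
    by have y2 := sqr_ge0 y; apply/andP; split; nra.
  have := acos_ge0 x1; have := acos_lepi x1; move=> a1 a0.
  have sxy : sin (acos x) = `|y|.
    by rewrite sin_acos // -sqrtr_sqr; congr Num.sqrt; lra.
  have cx : cos (acos x) = x by apply: acosK; rewrite in_itv.
  have [y0|y0] := leP 0 y.
    exists (acos x / k).
      rewrite /= in_itv /= divr_ge0 //= ?ler_pdivrMr ?(ltW k0) //.
      by rewrite mulrC kW mulr2n; lra.
    by rewrite mulrC mulfVK ?gt_eqF // cx sxy ger0_norm.
  (* The lower half circle is reached by running backwards from [W]. *)
  exists (W - acos x / k).
    rewrite /= in_itv /= subr_ge0 gerBl divr_ge0 ?(ltW k0) // andbT.
    by rewrite ler_pdivrMr // mulrC kW mulr2n; lra.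
  rewrite mulrBr kW [k * (_ / _)]mulrC mulfVK ?gt_eqF //.
  rewrite cosB sinB cos2pi sin2pi cx sxy ltr0_norm //.
  by congr (_, _); ring.
- by rewrite mulr0 cos0 sin0 kW cos2pi sin2pi.
move=> s s' sW s'W [cE sE].
(* Equal sines and cosines give the difference of the angles cosine 1. *)
have := @cos_eq1 _ (k * s - k * s').
rewrite cosB cE sE -!expr2 cos2Dsin2 -mulrBr normrM (gtr0_norm k0).
case=> //.
- by rewrite -kW ler_pM2l // ler_norml; lra.
- by move=> /eqP; rewrite mulf_eq0 gt_eqF //= subr_eq0 => /eqP; left.
- by rewrite -kW => /(mulfI (lt0r_neq0 k0)) ->; right.
Qed.

(** * The Freudenthal compactification is Hausdorff *)

Section FreudenthalHausdorff.
Context (R : realType) (V : choiceType) (G : graph V).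
Implicit Types (S D : set V) (a : set (nat -> V)) (x y v : V) (t : R).

Lemma edge_ptN0 x y t v : edge_pt x y t v != 0 -> v = x \/ v = y.
Proof.
rewrite /edge_pt; have [->|_] := eqVneq v x; first by left.
have [->|_] := eqVneq v y; first by right.
by rewrite !mulr0 addr0 eqxx.
Qed.

Lemma edge_ptl x y t : x != y -> edge_pt x y t x = 1 - t.
Proof. by move=> /negbTE xy; rewrite /edge_pt eqxx xy mulr1 mulr0 addr0. Qed.

Lemma edge_ptr x y t : x != y -> edge_pt x y t y = t.
Proof.
by move=> /negbTE xy; rewrite /edge_pt eqxx eq_sym xy mulr1 mulr0 add0r.
Qed.

Lemma edge_pt0 x y : edge_pt x y 0 = vertex_pt R x.
Proof. by apply/funext => w; rewrite /edge_pt subr0 mul1r mul0r addr0. Qed.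

Lemma edge_pt1 x y : edge_pt x y 1 = vertex_pt R y.
Proof. by apply/funext => w; rewrite /edge_pt subrr mul1r mul0r add0r. Qed.

Lemma edge_pt_swap x y t : edge_pt y x (1 - t) = edge_pt x y t.
Proof. by apply/funext => w; rewrite /edge_pt addrC opprB addrCA subrr addr0. Qed.

Lemma adj_neq x y : adj G x y -> x != y.
Proof. by apply: contraL => /eqP->; rewrite adj_irr. Qed.

Lemma adj_vertsr x y : adj G x y -> verts G y.
Proof. by rewrite adj_sym => /adj_verts. Qed.

Lemma complex_edge_pt x y t : adj G x y -> 0 <= t <= 1 ->
  complex_pts R G (edge_pt x y t).
Proof.
move=> xy /andP[]; rewrite !le_eqVlt => /predU1P[<- _|t0 /predU1P[->|t1]].
- by left; exists x; [exact: adj_verts xy|rewrite edge_pt0].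
- by left; exists y; [exact: adj_vertsr xy|rewrite edge_pt1].
- by right; exists x, y, t; rewrite t0 t1.
Qed.

Definition complex_point (p : V -> R) (h : complex_pts R G p) :
  set_type (complex_pts R G) := exist _ p (mem_set h).

Lemma components_verts S D x :
  components (del_verts G S) D -> D x -> verts G x /\ ~ S x.
Proof. by move=> [u _ ->] /linked_verts. Qed.

Lemma components_adj S D x y : components (del_verts G S) D ->
  D x -> adj G x y -> ~ S y -> D y.
Proof.
move=> DS Dx xy Sy; have [Gx Sx] := components_verts DS Dx.
case: DS Dx => u Gu -> /= ux; apply: linked_trans ux _; split=> //.
by exists [:: y] => //=; rewrite xy !mem_set.
Qed.

Lemma end_comp_component S a : finite_set S -> S `<=` verts G -> ends G a ->
  components (del_verts G S) (end_comp G S a) /\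
  forall r, a r -> has_tail (end_comp G S a) r.
Proof.
move=> finS SG aG; have [D DS Da] := end_comp_exists finS SG aG.
by rewrite (end_compE aG DS Da).
Qed.

(** An edge that leaves the component must end in [S], so vertices, inner edges and cut edges are
    all covered by one condition on the support of the barycentric coordinates. *)
Lemma end_nbhd_complexE S a (p : set_type (complex_pts R G)) :
  finite_set S -> S `<=` verts G -> ends G a ->
  end_nbhd R G S a (ComplexPt p) <->
  exists2 v, end_comp G S a v & \val p v != 0.
Proof.
move=> finS SG aG; have [CS _] := end_comp_component finS SG aG.
have CSn x : end_comp G S a x -> ~ S x by case/(components_verts CS).
split=> [[[[v [_ Cv] pE]|[x [y [t [/and3P[xy Cx Cy] t01 pE]]]]]|]|].
- by exists v => //; rewrite pE /vertex_pt eqxx oner_eq0.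
- exists x; first exact: set_mem.
  by rewrite pE edge_ptl ?adj_neq // subr_eq0; case/andP: t01 => _ /gt_eqF->.
- move=> [x [y [t [xy Sx Cy [t01 pE]]]]]; exists y => //.
  by rewrite pE edge_ptr ?adj_neq //; case/andP: t01 => /gt_eqF->.
move=> [v Cv]; have [] := set_mem (valP p).
  move=> [u Gu pE]; rewrite pE /vertex_pt.
  have [vu _|] := eqVneq v u; last by rewrite eqxx.
  by rewrite -vu in Gu pE; left; left; exists v.
(* If the other end [y] lies in [S], the edge has to be reversed, because [cut_pts] lists the end in
   [S] first. *)
have half x y t : adj G x y -> 0 < t < 1 -> \val p = edge_pt x y t ->
    end_comp G S a x -> end_nbhd R G S a (ComplexPt p).
  move=> xy t01 pE Cx; have [Cy|nCy] := pselect (end_comp G S a y).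
    by left; right; exists x, y, t; split=> //=; rewrite xy !mem_set.
  have [Sy|nSy] := pselect (S y); last first.
    by case: nCy; exact: components_adj CS Cx xy nSy.
  right; exists y, x, (1 - t); split=> //; first by rewrite adj_sym.
  by rewrite edge_pt_swap pE; split=> //; lra.
move=> [x [y [t [xy t01 pE]]]]; rewrite pE => /edge_ptN0[vx|vy].
  by apply: (half x y t) => //; rewrite -vx.
apply: (half y x (1 - t)); [by rewrite adj_sym|by lra| |by rewrite -vy].
by rewrite edge_pt_swap.
Qed.

(** The trace on an edge [xy] is given by [t < 1] if [x] is in the component, together with [0 < t]
    if [y] is. An end inside has the same component, so the same [S] serves it. *)
Lemma end_nbhd_open S a : finite_set S -> S `<=` verts G -> ends G a ->
  open (end_nbhd R G S a).
Proof.
move=> finS SG aG; set C := end_comp G S a.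
suff : freudenthal_open (end_nbhd R G S a) by [].
split=> [x y xy|b bC]; last first.
  exists S; split=> // p; case: p => [p|c] /=; first by rewrite bC.
  by move=> ->.
apply/open_subspaceP.
exists ([set t | C x /\ t < 1] `|` [set t | C y /\ 0 < t]).
  apply: openU.
    have [Cx|nCx] := pselect (C x).
      rewrite (_ : [set t | _] = [set t | t < 1]); first exact: open_lt.
      by apply/seteqP; split=> t //= [].
    rewrite (_ : [set t | _] = set0); first exact: open0.
    by apply/seteqP; split=> t //= [].
  have [Cy|nCy] := pselect (C y).
    rewrite (_ : [set t | _] = [set t | 0 < t]); first exact: open_gt.
    by apply/seteqP; split=> t //= [].
  rewrite (_ : [set t | _] = set0); first exact: open0.
  by apply/seteqP; split=> t //= [].
have nxy := adj_neq xy.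
apply/seteqP; split=> t [tC t01]; split=> //; have := t01;
  rewrite /= in_itv /= => /andP[t0 t1].
  exists (complex_point (complex_edge_pt xy t01)) => //.
  apply/end_nbhd_complexE => //=.
  case: tC => /= [[Cx lt1]|[Cy gt0]].
    by exists x => //; rewrite edge_ptl // subr_eq0 gt_eqF.
  by exists y => //; rewrite edge_ptr // gt_eqF.
case: tC => p pE /(end_nbhd_complexE p finS SG aG)[v Cv].
rewrite pE => h; case: (edge_ptN0 h) => vE; subst v; move: h; [left|right]; split=> //.
  by move: h; rewrite edge_ptl // subr_eq0 eq_sym => h; rewrite lt_neqAle h.
by move: h; rewrite edge_ptr // => h; rewrite lt_neqAle eq_sym h.
Qed.

Lemma ray_equiv_sym r r' : ray_equiv G r r' -> ray_equiv G r' r.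
Proof. by move=> rr' S fS SG; have [D DS []] := rr' S fS SG; exists D. Qed.

Lemma ray_equiv_trans r1 r2 r3 :
  ray_equiv G r1 r2 -> ray_equiv G r2 r3 -> ray_equiv G r1 r3.
Proof.
move=> r12 r23 S fS SG; have [D DS [D1 D2]] := r12 S fS SG.
have [D' D'S [D2' D3]] := r23 S fS SG; exists D => //; split=> //.
have [x Dx D'x] := has_tail_meet D2 D2'.
by rewrite (components_meet DS D'S Dx D'x).
Qed.

Definition end_of (r : nat -> V) : set (nat -> V) :=
  [set r' | ray G r' /\ ray_equiv G r r'].

Lemma end_of_inj r r' : ray G r' -> end_of r = end_of r' -> ray_equiv G r r'.
Proof.
move=> r'G; have : end_of r' r' by split=> //; exact: ray_equiv_refl.
by move=> + E; rewrite -E => -[].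
Qed.

Lemma end_comp_inj a b : ends G a -> ends G b ->
  (forall S, finite_set S -> S `<=` verts G ->
     end_comp G S a = end_comp G S b) -> a = b.
Proof.
move=> aG bG ab; case: (aG) (bG) => [r rG aE] [r' r'G bE].
have rr' : ray_equiv G r r'.
  move=> S fS SG; have [CS Ca] := end_comp_component fS SG aG.
  have [_ Cb] := end_comp_component fS SG bG.
  exists (end_comp G S a) => //; split.
    by apply: Ca; rewrite aE; split=> //; exact: ray_equiv_refl.
  by rewrite ab //; apply: Cb; rewrite bE; split=> //; exact: ray_equiv_refl.
rewrite aE bE; apply/seteqP; split=> s [sG rs]; split=> //.
  exact: ray_equiv_trans (ray_equiv_sym rr') rs.
exact: ray_equiv_trans rr' rs.
Qed.

Definition coord (v : V) (p : freudenthal R G) : R :=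
  if p is ComplexPt q then \val q v else 0.

(** Local finiteness makes [v] with its neighbours a finite set [S]; no edge at [v] meets a
    component of [G - S], so the coordinate vanishes on a whole neighbourhood of each end. *)
Lemma coord_continuous v : locally_finite G -> continuous (coord v).
Proof.
move=> lfG; apply/continuousP => U oU.
suff : freudenthal_open (coord v @^-1` U) by [].
split=> [x y xy|a U0].
  apply/open_subspaceP; exists ((fun t => edge_pt x y t v) @^-1` U).
    have : continuous (fun t : R => edge_pt x y t v).
      move=> t; apply: cvgD; apply: cvgM; try exact: cvg_cst; last exact: cvg_id.
      by apply: cvgB; [exact: cvg_cst|exact: cvg_id].
    by move/continuousP; exact.
  apply/seteqP; split=> t [tU t01]; split=> //.
    by exists (complex_point (complex_edge_pt xy t01)).
  by case: tU => p pE; rewrite /= pE.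
have [Gv|nGv] := pselect (verts G v); last first.
  exists set0; split=> //.
  case=> [p _|//] /=; suff -> : \val p v = 0 by [].
  apply: contrapT => /eqP pv; have [] := set_mem (valP p).
    move=> [u Gu pE]; move: pv; rewrite pE /vertex_pt.
    by have [vu|] := eqVneq v u; [rewrite vu in nGv|rewrite eqxx].
  move=> [x [y [t [xy _ pE]]]]; move: pv; rewrite pE => /edge_ptN0[]vE.
    by apply: nGv; rewrite vE; exact: adj_verts xy.
  by apply: nGv; rewrite vE; exact: adj_vertsr xy.
have aG : ends G (\val a) by exact: set_mem (valP a).
pose S := [set v] `|` [set w | adj G v w].
have fS : finite_set S by rewrite finite_setU; split=> //; exact: lfG.
have SG : S `<=` verts G by move=> w [->//|/adj_vertsr].
exists S; split=> //; case=> [p|//] /(end_nbhd_complexE p fS SG aG)[w Cw pw] /=.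
have [CS _] := end_comp_component fS SG aG.
have [Gw Sw] := components_verts CS Cw.
suff -> : \val p v = 0 by [].
apply: contrapT => /eqP pv; apply: Sw; have [] := set_mem (valP p).
  move=> [u Gu pE]; move: pv pw; rewrite pE /vertex_pt.
  have [vu|] := eqVneq v u; last by rewrite eqxx.
  by have [wu|] := eqVneq w u; [left; rewrite /= wu vu|rewrite eqxx].
move=> [x [y [t [xy _ pE]]]]; move: pv pw; rewrite pE.
move=> /edge_ptN0[]vE /edge_ptN0[]wE; rewrite /S /= vE wE; try by left.
  by right.
by right; rewrite adj_sym.
Qed.

Lemma cluster_continuous_eq (X : topologicalType) (h : X -> R) (p q : X) :
  continuous h -> cluster (nbhs p) q -> h p = h q.
Proof.
move=> hc pq; apply: (@Rhausdorff R) => A B Ap Bq.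
have [x [Ax Bx]] := pq _ _ (hc p _ Ap) (hc q _ Bq).
by exists (h x).
Qed.

Lemma complex_pt_neq0 p : complex_pts R G p -> exists v, p v != 0.
Proof.
move=> [[v _ ->]|[x [y [t [xy t01 ->]]]]].
  by exists v; rewrite /vertex_pt eqxx oner_eq0.
by exists y; rewrite edge_ptr ?adj_neq //; case/andP: t01 => /gt_eqF->.
Qed.

(** The coordinates separate points of the complex from each other and from ends, where all of them
    vanish. For two ends, a point in both neighbourhoods has support in an edge, and this links the
    two components. *)
Lemma freudenthal_hausdorff : locally_finite G ->
  hausdorff_space (freudenthal R G).
Proof.
move=> lfG p q pq.
have pqv v : coord v p = coord v q.
  exact: (cluster_continuous_eq (@coord_continuous v lfG) pq).
case: p q pq pqv => [p|a] [q|b] pq pqv.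
- by congr ComplexPt; apply: val_inj; exact/funext.
- by have [v] := complex_pt_neq0 (set_mem (valP p)); rewrite (pqv v : \val p v = 0) eqxx.
- by have [v] := complex_pt_neq0 (set_mem (valP q)); rewrite -(pqv v : 0 = \val q v) eqxx.
have aG : ends G (\val a) by exact: set_mem (valP a).
have bG : ends G (\val b) by exact: set_mem (valP b).
congr EndPt; apply: val_inj; apply: end_comp_inj => // S fS SG.
have [CaS _] := end_comp_component fS SG aG.
have [CbS _] := end_comp_component fS SG bG.
have [] := pq (end_nbhd R G S (\val a)) (end_nbhd R G S (\val b)).
- by apply: open_nbhs_nbhs; split; [exact: end_nbhd_open|].
- by apply: open_nbhs_nbhs; split; [exact: end_nbhd_open|].
case=> [x|c] [/= ]; last by move=> -> ->.
move=> /(end_nbhd_complexE x fS SG aG)[u Cu xu].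
move=> /(end_nbhd_complexE x fS SG bG)[v Cv xv].
suff Cav : end_comp G S (\val a) v by exact: components_meet CaS CbS Cav Cv.
have [_ Sv] := components_verts CbS Cv.
have [] := set_mem (valP x).
  move=> [z Gz xE]; move: xu xv; rewrite xE /vertex_pt.
  have [uz|] := eqVneq u z; last by rewrite eqxx.
  by have [vz|] := eqVneq v z; [rewrite vz -uz|rewrite eqxx].
move=> [y [z [t [yz _ xE]]]]; move: xu xv; rewrite xE.
move=> /edge_ptN0[]uE /edge_ptN0[]vE; try by rewrite vE -uE.
  by apply: components_adj CaS Cu _ Sv; rewrite uE vE.
by apply: components_adj CaS Cu _ Sv; rewrite uE vE adj_sym.
Qed.

End FreudenthalHausdorff.

(** * Rooted trees *)

Lemma cycle_not_acyclic (V : choiceType) (T : graph V) (c : seq V) :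
  uniq c -> (3 <= size c)%N -> cycle (adj T) c -> ~ acyclic T.
Proof.
move=> uc c3 cc acT.
pose a x y := [&& x \in c, y \in c & (y == next c x) || (x == next c y)].
have as_ : symmetric a by move=> x y; rewrite /a andbCA orbC.
have nextT x : x \in c -> adj T x (next c x) by exact: next_cycle.
have aT x y : a x y -> adj T x y.
  case/and3P => xc yc /orP[/eqP->|/eqP->]; first exact: nextT.
  by rewrite adj_sym; exact: nextT.
have ai : irreflexive a by move=> x; apply/negP => /aT; rewrite adj_irr.
have av x y : a x y -> [set` c] x by case/and3P.
apply: acT; exists (Graph as_ ai av); split; last by exists c.
by split=> //= x xc; exact: adj_verts (nextT x xc).
Qed.

Lemma subgraph_acyclic (V : choiceType) (H T : graph V) :
  subgraph H T -> acyclic T -> acyclic H.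
Proof.
move=> [HTv HTa] aT [C [[CHv CHa] Cc]]; apply: aT; exists C; split=> //.
by split=> [x /CHv/HTv//|x y /CHa/HTa].
Qed.

(** The convention [par v0 = v0] makes [par] total on [T] and lets its iterates run past the
    root. *)
Record rooted (V : choiceType) (T : graph V) (v0 : V) (d : V -> nat)
    (par : V -> V) : Prop := Rooted {
  rooted_root : verts T v0 ;
  rooted_level0 : d v0 = 0%N ;
  rooted_par0 : par v0 = v0 ;
  rooted_adj_par : forall v, verts T v -> v != v0 -> adj T (par v) v ;
  rooted_levelS : forall v, verts T v -> v != v0 -> d v = (d (par v)).+1 ;
  rooted_adj : forall x y, adj T x y ->
    (y != v0 /\ x = par y) \/ (x != v0 /\ y = par x) }.

Section TreeRooted.
Context (V : choiceType) (T : graph V) (v0 : V).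
Context (tT : is_tree T) (Tv0 : verts T v0).

Let reach v n := exists p, [/\ path (adj T) v0 p, last v0 p = v & size p = n].

Let exd : exists d : V -> nat, forall v, verts T v ->
  reach v (d v) /\ forall n, reach v n -> (d v <= n)%N.
Proof.
have h v : exists k, verts T v -> reach v k /\ forall n, reach v n -> (k <= n)%N.
  have [Tv|nTv] := pselect (verts T v); last by exists 0%N.
  have ex : exists n, `[< reach v n >].
    have [_ [p pT vE]] := tT.1.2 _ _ Tv0 Tv.
    by exists (size p); apply/asboolP; exists p.
  case: (ex_minnP ex) => n /asboolP rn nP; exists n => _.
  by split=> // m /asboolP/nP.
by have [d dP] := boolp.choice h; exists d.
Qed.

(** [d] is the distance from [v0]; an edge that does not join a vertex to its parent would close a
    cycle. *)
Lemma tree_rooted : exists d par, rooted T v0 d par.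
Proof.
have [d dP] := exd.
have d0 : d v0 = 0%N.
  by apply/eqP; rewrite -leqn0; apply: (dP v0 Tv0).2; exists [::].
have d0E v : verts T v -> d v = 0%N -> v = v0.
  move=> Tv dv; have [[p [_ pl ps]] _] := dP v Tv.
  by rewrite dv in ps; rewrite -pl (size0nil ps).
have dS x y : adj T x y -> (d y <= (d x).+1)%N.
  move=> xy; have [[p [pT pl ps]] _] := dP x (adj_verts xy).
  apply: (dP y (adj_vertsr xy)).2; exists (rcons p y).
  by rewrite rcons_path pT pl xy last_rcons size_rcons ps.
have exu v : verts T v -> v != v0 -> exists u, adj T u v /\ d v = (d u).+1.
  move=> Tv vv0; have [[p [pT pl ps]] _] := dP v Tv.
  case/lastP: p pT pl ps vv0 => [_ /= <-|p u]; first by rewrite eqxx.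
  rewrite rcons_path last_rcons size_rcons => /andP[pT lu] uv ps _.
  rewrite uv in lu; exists (last v0 p); split=> //.
  apply/eqP; rewrite eqn_leq dS //= -ps ltnS.
  by apply: (dP _ (adj_verts lu)).2; exists p.
(* At [v0] no such [u] exists, and the default value makes the root its own parent. *)
pose par v := xget v0 [set u | adj T u v /\ d v = (d u).+1].
have parP v : verts T v -> v != v0 -> adj T (par v) v /\ d v = (d (par v)).+1.
  by move=> Tv vv0; have := xgetPex v0 (exu v Tv vv0).
have par0 : par v0 = v0 by rewrite /par; case: xgetP => // x _ []; rewrite d0.
(* Two vertices of the same level are joined by a path through lower levels:
   climb from both until the ancestors meet. *)
have cyc n x y : verts T x -> verts T y -> d x = n -> d y = n -> x != y ->
    exists p, [/\ uniq (x :: p), path (adj T) x p, last x p = y,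
      (2 <= size p)%N & forall z, z \in x :: p -> (d z <= n)%N].
  elim: n x y => [|n IH] x y Tx Ty dx dy xy.
    by move: xy; rewrite (d0E x) // (d0E y) // eqxx.
  have x0 : x != v0 by apply: contra_eq_neq dx => ->; rewrite d0.
  have y0 : y != v0 by apply: contra_eq_neq dy => ->; rewrite d0.
  have [xa xd] := parP x Tx x0; have [ya yd] := parP y Ty y0.
  move: (xd) (yd); rewrite dx dy => -[xn] [yn].
  have neq z : (d z <= n)%N -> (z != x) /\ (z != y).
    by move=> zn; split; apply: contraTneq zn => ->; rewrite ?dx ?dy ltnn.
  have [pxy|pxy] := eqVneq (par x) (par y).
    exists [:: par x; y]; split=> //=; last first.
    - by move=> z; rewrite !inE => /or3P[]/eqP->; rewrite ?dx ?dy // -xn.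
    - by rewrite adj_sym xa pxy ya.
    - have [|n1 n2] := neq (par x); first by rewrite -xn.
      by rewrite !inE negb_or xy n2 eq_sym n1.
  have [p [up pT pl ps pn]] :=
    IH _ _ (adj_verts xa) (adj_verts ya) (esym xn) (esym yn) pxy.
  exists (par x :: rcons p y); split.
  - rewrite -rcons_cons cons_uniq rcons_uniq up andbT mem_rcons in_cons negb_or xy.
    by apply/andP; split; apply/negP => /pn /neq[]; rewrite eqxx.
  - by rewrite /= adj_sym xa rcons_path pT pl ya.
  - by rewrite /= last_rcons.
  - by rewrite /= size_rcons.
  - move=> z; rewrite -rcons_cons in_cons mem_rcons in_cons.
    by move=> /or3P[/eqP->|/eqP->|/pn/leqW//]; rewrite ?dx ?dy.
have close x p : uniq (x :: p) -> path (adj T) x p -> (2 <= size p)%N ->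
    ~ adj T (last x p) x.
  move=> up pT ps xp; apply: (cycle_not_acyclic up _ _ tT.2) => //.
  by rewrite /= rcons_path pT.
exists d, par; split=> //.
- by move=> v Tv /(parP v Tv)[].
- by move=> v Tv /(parP v Tv)[].
suff H x y : adj T x y -> (d x <= d y)%N -> y != v0 /\ x = par y.
  move=> x y xy; have [|/ltnW] := leqP (d x) (d y); first by left; exact: H.
  by rewrite adj_sym in xy; right; exact: H.
move=> xy; rewrite leq_eqVlt => /predU1P[dxy|dxy].
  have [p [up pT pl ps _]] :=
    cyc _ _ _ (adj_verts xy) (adj_vertsr xy) dxy erefl (adj_neq xy).
  by case: (close x p) => //; rewrite pl adj_sym.
have y0 : y != v0 by apply: contraTneq dxy => ->; rewrite d0.
split=> //; apply/eqP/contraT => xpy.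
have [ya yd] := parP y (adj_vertsr xy) y0.
have dx : d x = d (par y) by apply/eqP; rewrite eqn_leq -ltnS -yd dxy -ltnS -yd dS.
(* A second lower neighbour [x] of [y] has the level of [par y]; the path between them stays below
   [y], so [y] closes it to a cycle. *)
have [p [up pT pl ps pn]] :=
  cyc _ _ _ (adj_verts xy) (adj_verts ya) dx erefl xpy.
case: (close x (rcons p y)); last by rewrite last_rcons adj_sym.
- rewrite -rcons_cons rcons_uniq up andbT; apply/negP => /pn.
  by rewrite yd ltnn.
- by rewrite rcons_path pT pl ya.
- by rewrite size_rcons (leq_trans ps).
Qed.

End TreeRooted.

(** * Branches of a rooted tree and their fundamental cuts *)

Section Descendants.
Context (V : choiceType) (T : graph V) (v0 : V) (d : V -> nat) (par : V -> V).
Context (rT : rooted T v0 d par).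
Implicit Types u v x y : V.

(** For [v != v0] this is the part of [T] behind the edge from [par v] to [v], seen from the
    root. *)
Definition descendants v : set V :=
  [set u | verts T u /\ exists k, iter k par u = v].
Local Notation D := descendants.

Lemma par_verts v : verts T v -> verts T (par v).
Proof.
move=> Tv; have [->|v0P] := eqVneq v v0.
  by rewrite (rooted_par0 rT); exact: (rooted_root rT).
exact: adj_verts (rooted_adj_par rT Tv v0P).
Qed.

Lemma level_par v : verts T v -> d (par v) = (d v).-1.
Proof.
move=> Tv; have [->|v0P] := eqVneq v v0.
  by rewrite (rooted_par0 rT) (rooted_level0 rT).
by rewrite (rooted_levelS rT Tv v0P).
Qed.

Lemma iter_par_verts k v : verts T v -> verts T (iter k par v).
Proof. by move=> Tv; elim: k => //= k; exact: par_verts. Qed.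

Lemma level_iter_par k v : verts T v -> d (iter k par v) = (d v - k)%N.
Proof.
move=> Tv; elim: k => [|k IH]; first by rewrite subn0.
by rewrite /= level_par ?IH ?subnS //; exact: iter_par_verts.
Qed.

Lemma level_eq0 v : verts T v -> d v = 0%N -> v = v0.
Proof. by move=> Tv; apply: contra_eq => /(rooted_levelS rT Tv) ->. Qed.

Lemma level_gt0 v : verts T v -> v != v0 -> (0 < d v)%N.
Proof. by move=> Tv /(rooted_levelS rT Tv) ->. Qed.

Lemma descendants_refl v : verts T v -> D v v.
Proof. by move=> Tv; split=> //; exists 0%N. Qed.

Lemma descendants_verts v u : D v u -> verts T u.
Proof. by case. Qed.

Lemma descendants_top v u : D v u -> verts T v.
Proof. by case=> Tu [k <-]; exact: iter_par_verts. Qed.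

Lemma descendants_iter v u : D v u ->
  (d v <= d u)%N /\ iter (d u - d v) par u = v.
Proof.
move=> [Tu [k kE]].
have dk : d v = (d u - k)%N by rewrite -kE level_iter_par.
rewrite dk leq_subr; split=> //.
(* More than [d u] steps end at the root, which is already reached after [d u] of them. *)
have [ku|/ltnW uk] := leqP k (d u); first by rewrite subKn.
have v0E : v = v0.
  by apply: level_eq0; rewrite ?dk -?kE; [exact: iter_par_verts|apply/eqP; rewrite subn_eq0].
have := uk; rewrite -subn_eq0 => /eqP ->; rewrite subn0 v0E.
by apply: level_eq0; [exact: iter_par_verts|rewrite level_iter_par ?subnn].
Qed.

Lemma descendants_level_inj v v' u : D v u -> D v' u -> d v = d v' -> v = v'.
Proof.
by move=> /descendants_iter[_ vE] /descendants_iter[_ v'E] dE; rewrite -vE dE.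
Qed.

Lemma descendants_par v u : D v u -> u != v -> u != v0 /\ D v (par u).
Proof.
move=> [Tu [k kE]] uv; have uv0 : u != v0.
  apply: contra_neq uv => u0; rewrite -kE u0; elim: k {kE} => //= k <-.
  by rewrite (rooted_par0 rT).
split=> //; split; first exact: par_verts.
case: k kE => [/= uE|k]; first by rewrite uE eqxx in uv.
by rewrite iterSr; exists k.
Qed.

Lemma descendants_child v u : verts T u -> D v (par u) -> D v u.
Proof. by move=> Tu [_ [k kE]]; split=> //; exists k.+1; rewrite iterSr. Qed.

Lemma descendants_root u : verts T u -> D v0 u.
Proof.
move=> Tu; split=> //; exists (d u); apply: level_eq0.
  exact: iter_par_verts.
by rewrite level_iter_par // subnn.
Qed.

Lemma descendants_notroot v : verts T v -> v != v0 -> ~ D v v0.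
Proof.
move=> Tv vv0 /descendants_iter[]; rewrite (rooted_level0 rT) leqn0 => /eqP dv.
by rewrite (level_eq0 Tv dv) eqxx in vv0.
Qed.

Lemma descendants_exit v x y : adj T x y -> D v x -> ~ D v y ->
  [/\ v != v0, x = v & y = par v].
Proof.
move=> xy Dx nDy; case: (rooted_adj rT xy) => -[].
  move=> y0 xE; case: nDy; apply: descendants_child; first exact: adj_vertsr xy.
  by rewrite -xE.
move=> x0 yE; have [xv|xv] := eqVneq x v; first by rewrite -xv.
by have [_] := descendants_par Dx xv; rewrite -yE.
Qed.

(** [H] is arbitrary because the lemma serves both [T] minus an edge and [G] minus a finite vertex
    set. *)
Lemma linked_descendants (H : graph V) v u : verts H v ->
  (forall w, D v w -> w != v -> adj H (par w) w) -> D v u -> linked H v u.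
Proof.
move=> Hv Hadj; move: {2}(d u) (leqnn (d u)) => n.
elim: n u => [|n IH] u un Du.
  have [->|uv] := eqVneq u v; first exact: linked_refl.
  have [u0 _] := descendants_par Du uv.
  by move: un; rewrite leqNgt level_gt0 //; case: Du.
have [->|uv] := eqVneq u v; first exact: linked_refl.
have [u0 Dpu] := descendants_par Du uv.
have a := Hadj _ Du uv; apply: linked_trans (IH (par u) _ Dpu) _.
  by rewrite -ltnS -(rooted_levelS rT _ u0) //; case: Du.
by split; [exact: adj_verts a|exists [:: u] => //=; rewrite a].
Qed.

Lemma linked_closed (H : graph V) (B : set V) x y :
  (forall a b, B a -> adj H a b -> B b) -> B x -> linked H x y -> B y.
Proof.
move=> BH Bx [_ [p pH ->]]; elim: p x Bx pH => //= z p IH x Bx /andP[xz].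
by apply: IH; exact: BH xz.
Qed.

(** The deleted edge is the only edge of [T] leaving [D v], so both sides are closed under [H];
    chains of parents to [v], respectively to [v0], stay on their side. *)
Lemma descendants_component v : verts T v -> v != v0 ->
  let H := del_edges T [set [set par v; v]] in
  [set u | linked H v u] = D v /\ [set u | linked H v0 u] = verts T `\` D v.
Proof.
move=> Tv vv0 H.
have Hadj x y : adj H x y = adj T x y && ([set x; y] != [set par v; v]).
  by rewrite /=; congr (_ && ~~ _); rewrite in_set1_eq.
have neqs x y : x != v -> y != v -> [set x; y] != [set par v; v].
  move=> xv yv; apply/eqP => /seteqP[_ /(_ v)] /= h.
  by case: h => [|vx|vy]; [by right|rewrite vx eqxx in xv|rewrite vy eqxx in yv].
have BH a b : D v a -> adj H a b -> D v b.
  move=> Da; rewrite Hadj => /andP[ab]; apply: contraNP => Db.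
  by have [_ -> ->] := descendants_exit ab Da Db; rewrite setUC.
have BH' a b : (verts T `\` D v) a -> adj H a b -> (verts T `\` D v) b.
  move=> [Ta nDa] ab; split; first exact: adj_vertsr ab.
  by move=> Db; apply: nDa; apply: BH Db _; rewrite adj_sym.
split; apply/seteqP; split=> u.
- by apply: linked_closed BH _; exact: descendants_refl.
- apply: linked_descendants => // w Dw wv.
  have [w0 Dpw] := descendants_par Dw wv.
  rewrite Hadj (rooted_adj_par rT (descendants_verts Dw) w0).
  apply/eqP => /seteqP[/(_ w)/= h _].
  case: h => [|wp|/eqP]; [by right| |by apply/negP].
  have := descendants_iter Dw; rewrite wp level_par // => -[+ _].
  by have := level_gt0 Tv vv0; lia.
- apply: linked_closed BH' _; split; first exact: (rooted_root rT).
  exact: descendants_notroot.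
- move=> [Tu nDu]; move: {2}(d u) (leqnn (d u)) => n.
  elim: n u Tu nDu => [|n IH] u Tu nDu un.
    rewrite (level_eq0 Tu) //=; last by apply/eqP; rewrite -leqn0.
    exact/linked_refl/(rooted_root rT).
  have [->|u0] := eqVneq u v0; first exact/linked_refl/(rooted_root rT).
  have nDpu : ~ D v (par u) by move/(descendants_child Tu).
  apply: linked_trans (IH _ (par_verts Tu) nDpu _) _.
    by rewrite -ltnS -(rooted_levelS rT Tu u0).
  split; first exact: (par_verts Tu).
  exists [:: u] => //=; rewrite andbT; change (adj H (par u) u).
  rewrite Hadj (rooted_adj_par rT Tu u0) neqs //.
    by apply/eqP => h; apply: nDpu; rewrite h; exact: descendants_refl.
  by apply/eqP => h; apply: nDu; rewrite h; exact: descendants_refl.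
Qed.

End Descendants.

(** * Rays from ultrafilters, and finite fundamental cuts *)

Lemma filter_meet (X : Type) (W : set_system X) (A B : set X) :
  ProperFilter W -> W A -> W B -> exists x, A x /\ B x.
Proof. by move=> FW WA WB; exact: (@filter_ex _ _ FW (A `&` B) (filterI WA WB)). Qed.

Lemma ultra_bigcup_finite (X I : Type) (W : set_system X) (A : set I)
    (B : I -> set X) : UltraFilter W -> finite_set A ->
  W (\bigcup_(i in A) B i) -> exists2 i, A i & W (B i).
Proof.
move=> UW /finite_setP[n]; elim: n A => [|n IH] A.
  rewrite II0 card_eq0 => /eqP->; rewrite bigcup_set0.
  by move=> /filter_ex[].
move=> /eq_cardSP[i Ai An] WA.
have [WB|WnB] := in_ultra_setVsetC (B i) UW; first by exists i.
have [j [Aj _] WBj] : exists2 j, (A `\ i) j & W (B j).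
  apply: IH An _; apply: filterS (filterI WA WnB) => x [[j Aj Bjx] nBix].
  by exists j => //; split=> // ji; apply: nBix; rewrite -ji.
by exists j.
Qed.

Section UltraRays.
Context (V : choiceType) (G T : graph V) (v0 : V) (d : V -> nat)
  (par : V -> V).
Context (lfG : locally_finite G) (TG : spanning T G) (rT : rooted T v0 d par).
Implicit Types (u v x y : V) (S : set V) (r : nat -> V).
Local Notation D := (descendants T par).

Definition rooted_ray r := r 0%N = v0 /\
  forall n, [/\ verts T (r n.+1), r n.+1 != v0 & par (r n.+1) = r n].

Lemma rooted_ray_verts r n : rooted_ray r -> verts T (r n).
Proof. by move=> [r0 /(_ n)[Tr _ <-]]; exact: (par_verts rT). Qed.

Lemma rooted_ray_level r n : rooted_ray r -> d (r n) = n.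
Proof.
move=> [r0 rS]; elim: n => [|n IH]; first by rewrite r0 (rooted_level0 rT).
by have [Tr r0' rp] := rS n; rewrite (rooted_levelS rT Tr r0') rp IH.
Qed.

Lemma rooted_ray_descendants r n m : rooted_ray r -> (n <= m)%N ->
  D (r n) (r m).
Proof.
move=> rr; elim: m => [|m IH].
  by rewrite leqn0 => /eqP->; exact/descendants_refl/rooted_ray_verts.
rewrite leq_eqVlt => /predU1P[->|nm].
  exact/descendants_refl/rooted_ray_verts.
have [Tr _ rp] := rr.2 m; apply: (descendants_child Tr).
by rewrite rp; exact: IH.
Qed.

Lemma rooted_ray_ray r : rooted_ray r -> ray T r.
Proof.
move=> rr; split.
  by move=> n m nm; rewrite -(rooted_ray_level n rr) nm rooted_ray_level.
by move=> n; have [Tr r0 <-] := rr.2 n; exact: (rooted_adj_par rT).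
Qed.

Lemma subgraph_ray r : ray T r -> ray G r.
Proof. by move=> [injr rT']; split=> // n; apply: TG.1.2; exact: rT'. Qed.

Lemma descendants_avoid S : finite_set S ->
  exists N, forall v u, (N <= d v)%N -> D v u -> ~ S u.
Proof.
move=> /finite_seqP[s sE]; exists (\max_(i <- s) d i).+1 => v u Nv Du Su.
have us : u \in s by move: Su; rewrite sE.
have [dvu _] := descendants_iter rT Du.
have : (d u <= \max_(i <- s) d i)%N by apply: (@leq_bigmax_seq _ s xpredT d u).
lia.
Qed.

Lemma descendants_linked S v u : ~ (S `&` D v !=set0) -> D v u ->
  linked (del_verts G S) v u.
Proof.
move=> SD Du; have Tv := descendants_top rT Du.
have nS w : D v w -> ~ S w by move=> Dw Sw; apply: SD; exists w.
apply: (linked_descendants rT _ _ Du).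
  by split; [apply: TG.1.1|apply: nS; exact: descendants_refl].
move=> w Dw wv; have [w0 Dpw] := descendants_par rT Dw wv.
apply/and3P; split; [|exact/mem_set/nS|exact/mem_set/nS].
by apply: TG.1.2; apply: (rooted_adj_par rT) w0; case: Dw.
Qed.

(** Deleting the single vertex [r n] suffices: [D (r n)] can be left in [T] only through it, so [r']
    ends up in [D (r n)], and ancestors of equal level coincide. *)
Lemma rooted_rays_equiv r r' : rooted_ray r -> rooted_ray r' ->
  ray_equiv T r r' -> r = r'.
Proof.
move=> rr rr' eqr; apply/funext => n; apply: contrapT => rn.
pose v := r n; have Tv : verts T v by exact: rooted_ray_verts.
have [B [z zT ->] [[k kB] [m mB]]] : exists2 B,
    components (del_verts T [set v]) B & has_tail B r /\ has_tail B r'.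
  by apply: eqr; [exact: finite_set1|move=> x ->].
have /linked_sym zk := kB (maxn k n) (leq_maxl _ _).
have km := linked_trans zk (mB (maxn m n) (leq_maxl _ _)).
have Dm : D v (r' (maxn m n)).
  apply: linked_closed km; last exact: rooted_ray_descendants (leq_maxr _ _).
  move=> a b Da /and3P[ab /set_mem av _]; apply: contrapT => nDb.
  by have [_ /av] := descendants_exit rT ab Da nDb.
apply: rn; apply: (descendants_level_inj rT Dm).
  exact: rooted_ray_descendants (leq_maxr _ _).
by rewrite !rooted_ray_level.
Qed.

(* There are finitely many children, so one of the branches at v
   belongs to W. *)
Lemma ultra_child (W : set_system V) v : UltraFilter W ->
  (forall x, ~ W [set x]) -> verts T v -> W (D v) ->
  exists c, [/\ verts T c, c != v0, par c = v & W (D c)].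
Proof.
move=> UW W1 Tv WD.
pose A := [set c | [/\ verts T c, c != v0 & par c = v]].
have finA : finite_set A.
  apply: (@sub_finite_set _ _ [set w | adj G v w]) => [c [Tc c0 <-]|].
    by apply: TG.1.2; exact: (rooted_adj_par rT).
  by apply: lfG; exact: TG.1.1.
have [c [Tc c0 cv] WDc] : exists2 c, A c & W (D c); last by exists c.
apply: ultra_bigcup_finite => //.
have [/W1//|] := in_ultra_setVsetC [set v] UW => Wnv.
apply: filterS (filterI WD Wnv) => u [Du uv].
have [dvu iu] := descendants_iter rT Du.
have Tu : verts T u by case: Du.
have : (0 < d u - d v)%N.
  by rewrite lt0n; apply/eqP => du; apply: uv; rewrite /= -iu du.
case kE : (d u - d v)%N iu => [//|k] /= iu _.
(* The child of [v] on the way to [u] is the last but one ancestor. *)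
exists (iter k par u); last by split=> //; exists k.
split=> //; first exact: (iter_par_verts rT).
apply/eqP => /(congr1 d); rewrite (level_iter_par rT) // (rooted_level0 rT).
by lia.
Qed.

(** König's infinity lemma with the ultrafilter choosing the branch; since it is not principal, the
    descent never stops at a vertex. *)
Lemma ultra_ray (W : set_system V) : UltraFilter W -> W (verts G) ->
  (forall x, ~ W [set x]) -> exists r, rooted_ray r /\ forall n, W (D (r n)).
Proof.
move=> UW WG W1.
have h v : exists c, verts T v -> W (D v) ->
    [/\ verts T c, c != v0, par c = v & W (D c)].
  have [[Tv WD]|nh] := pselect (verts T v /\ W (D v)).
    by have [c] := ultra_child UW W1 Tv WD; exists c.
  by exists v => Tv WD; case: nh.
have [f fP] := boolp.choice h; exists (fun n => iter n f v0).
have H n : verts T (iter n f v0) /\ W (D (iter n f v0)).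
  elim: n => [|n [Tn Wn]] /=; last by have [] := fP _ Tn Wn.
  split; first exact: (rooted_root rT).
  apply: filterS WG => u Gu; apply: (descendants_root rT).
  by rewrite TG.2.
split; last by move=> n; case: (H n).
by split=> // n /=; have [Tn Wn] := H n; have [] := fP _ Tn Wn.
Qed.

(* Every finite S misses D (r n) and D (r' n) for large n, and some edge of G
   joins these two sets. *)
Lemma ultra_rays_equiv (W W' : set_system V) r r' :
  rooted_ray r -> (forall n, W (D (r n))) ->
  rooted_ray r' -> (forall n, W' (D (r' n))) ->
  (forall A B, W A -> W' B -> exists x y, [/\ A x, B y & adj G x y]) ->
  ray_equiv G r r'.
Proof.
move=> rr Wr rr' W'r adjW S fS SG; have [N NS] := descendants_avoid fS.
have nS q n : rooted_ray q -> (N <= n)%N -> ~ (S `&` D (q n) !=set0).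
  move=> rq Nn [x [Sx Dx]]; apply: (NS (q n) x) => //.
  by rewrite rooted_ray_level.
have lnk q x : rooted_ray q -> D (q N) x -> linked (del_verts G S) (q N) x.
  by move=> rq Dx; apply: descendants_linked => //; exact: nS.
have [x [y [Dx Dy xy]]] := adjW _ _ (Wr N) (W'r N).
have lx := lnk _ _ rr Dx; have ly := lnk _ _ rr' Dy.
have [Gx nSx] := linked_verts lx; have [Gy nSy] := linked_verts ly.
have lxy : linked (del_verts G S) x y.
  by split=> //; exists [:: y] => //=; rewrite xy !mem_set.
exists [set z | linked (del_verts G S) (r N) z].
  by exists (r N) => //; case: lx.
split; exists N => k Nk /=.
  exact/lnk/rooted_ray_descendants.
apply: linked_trans (linked_trans lx lxy) (linked_trans (linked_sym ly) _).
exact/lnk/rooted_ray_descendants.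
Qed.

(* Otherwise the two sides of the cut would contain rays that are equivalent
   in G although the edge of T separates them in T. *)
Lemma faithful_finite_cut v : faithful T G -> verts T v ->
  finite_set [set x | D v x /\ exists2 y, ~ D v y & adj G x y].
Proof.
move=> fT Tv; set A := [set x | _]; apply: contrapT => infA.
have hx x : exists y, A x -> ~ D v y /\ adj G x y.
  have [[_ [y Dy xy]]|nA] := pselect (A x); first by exists y.
  by exists v => /nA.
have [h hP] := boolp.choice hx.
(* The cofinite filter on the infinite set [A] of cut vertices. *)
pose F0 : set_system V := [set B | finite_set (A `\` B)].
have F0F : ProperFilter F0.
  apply: Build_ProperFilter_ex.
    move=> B F0B; apply: contrapT => nB; apply: infA.
    apply: sub_finite_set F0B => x Ax; split=> // Bx.
    by apply: nB; exists x.
  split.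
  - by rewrite /F0 /= setDT; exact: finite_set0.
  - by move=> B C FB FC; rewrite /F0 /mkset setDIr finite_setU.
  - by move=> B C BC; apply: sub_finite_set => x [Ax nC]; split=> // /BC.
have F0A : F0 A by rewrite /F0 /= setDv; exact: finite_set0.
(* By local finiteness few [x] choose the same neighbour, which keeps the image of the ultrafilter
   under [h] from being principal. *)
have F0nbr y : verts G y -> F0 (~` [set x | A x /\ h x = y]).
  move=> Gy; apply: sub_finite_set (lfG Gy) => x [Ax] /contrapT[_ hxy].
  by have [_] := hP x Ax; rewrite hxy adj_sym.
have [W [UW F0W]] := ultraFilterLemma F0F.
have [W' [UW' hW']] := ultraFilterLemma (fmap_proper_filter h (ultra_proper (F := W))).
have WA : W A by exact: F0W.
have W1 x : ~ W [set x].
  move=> Wx; have : W (~` [set x]).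
    apply: F0W; apply: (sub_finite_set _ (finite_set1 x)) => z [_] /contrapT.
    by [].
  by move=> /(filter_meet _ Wx)[z []].
have imW B : W (h @^-1` B) -> W' B by move=> WB; exact: hW'.
have W'D : W' (~` D v).
  by apply: imW; apply: filterS WA => x Ax; case: (hP x Ax).
have W'G : W' (verts G).
  apply: imW; apply: filterS WA => x Ax; case: (hP x Ax) => _.
  exact: adj_vertsr.
have W'1 y : ~ W' [set y].
  move=> Wy; have [Gy|nGy] := pselect (verts G y); last first.
    by have [z [Gz zy]] := filter_meet _ W'G Wy; apply: nGy; rewrite -zy.
  have : W' (~` [set y]).
    apply: imW; apply: filterS (filterI WA (F0W _ (F0nbr _ Gy))) => x [Ax nh].
    by move=> hxy; apply: nh.
  by move=> /(filter_meet _ Wy)[z []].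
have WD : W (D v) by apply: filterS WA => x [].
have WG : W (verts G) by apply: filterS WD => x [/TG.1.1].
have [r [rr Wr]] := ultra_ray UW WG W1.
have [r' [rr' Wr']] := ultra_ray UW' W'G W'1.
have rr'E : r = r'.
  (* The edges from [x] to [h x] join large sets of the two ultrafilters, so the rays are equivalent
     in [G], and by faithfulness in [T]. *)
  apply: rooted_rays_equiv => //; apply/(fT.2 _ _ (rooted_ray_ray rr) (rooted_ray_ray rr')).
  apply: (ultra_rays_equiv rr Wr rr' Wr') => B C WB WC.
  have [Wh|Wnh] := in_ultra_setVsetC (h @^-1` C) UW.
    have [x [[Ax Bx] Cx]] := filter_meet _ (filterI WA WB) Wh.
    by exists x, (h x); split=> //; case: (hP x Ax).
  have : W' (~` C) by exact: imW.
  by move=> /(filter_meet _ WC)[z []].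
(* The common ray passes through [v], so [D v] would be large for [W'] along with its complement. *)
have rv : r (d v) = v.
  have [x [Dx Drx]] := filter_meet _ WD (Wr (d v)).
  by apply: (descendants_level_inj rT Drx Dx); rewrite rooted_ray_level.
have : W' (D v) by have := Wr' (d v); rewrite -rr'E rv.
by move=> /(filterI W'D)/filter_ex[z []].
Qed.

End UltraRays.

(** * Cycles crossing the edges of F twice *)

Lemma card_two_three (X : Type) (A : set X) (x y z : X) :
  (A #= `I_2)%card -> A x -> A y -> A z -> [\/ x = y, y = z | x = z].
Proof.
move=> /eq_cardSP[a Aa /eq_cardSP[b Ab]]; rewrite II0 card_eq0 => /eqP A0.
have AE w : A w -> w = a \/ w = b.
  move=> Aw; apply: contrapT => /not_orP[wa wb].
  by have : (set0 : set X) w by rewrite -A0.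
move=> /AE[]-> /AE[]-> /AE[]->; try by [constructor 1|constructor 2|constructor 3].
Qed.

Lemma switch_index (P : nat -> Prop) i j : (i <= j)%N -> P i -> ~ P j ->
  exists p, [/\ (i <= p)%N, (p < j)%N, P p & ~ P p.+1].
Proof.
move=> + Pi; elim: j => [|j IH].
  by rewrite leqn0 => /eqP i0; rewrite i0 in Pi => /(_ Pi).
rewrite leq_eqVlt => /predU1P[iE|ij] nPj; first by rewrite iE in Pi.
have [Pj|/(IH ij)[p [ip pj Pp nPp]]] := pselect (P j); first by exists j.
by exists p; split=> //; exact: ltnW.
Qed.

Lemma next_nthS (X : eqType) (x0 : X) (c : seq X) p : uniq c ->
  (p.+1 < size c)%N -> next c (nth x0 c p) = nth x0 c p.+1.
Proof.
case: c => // y c uc pc; rewrite next_nth mem_nth ?(ltnW pc) //.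
rewrite index_uniq ?(ltnW pc) //.
by rewrite /=; apply: set_nth_default.
Qed.

Section CycleCrossing.
Context (V : choiceType) (C : graph V) (c : seq V) (x0 : V).
Context (uc : uniq c) (Cadj : forall x y, adj C x y =
  [&& x \in c, y \in c & (y == next c x) || (x == next c y)]).
Local Notation "c_[ i ]" := (nth x0 c i) (at level 0).

(** Both directions are recorded because [crosses] does not tell which of its two components is
    behind the edge. *)
Lemma crossing_path (A B : set V) p : (p.+1 < size c)%N ->
  (forall x, x \in c -> B x <-> ~ A x) -> A c_[p] -> ~ A c_[p.+1] ->
  AB_paths C A B [:: c_[p]; c_[p.+1]] /\ AB_paths C B A [:: c_[p.+1]; c_[p]].
Proof.
move=> pc AB Ap Ap'; have pc' : (p < size c)%N by exact: ltnW.
have [xc yc] : c_[p] \in c /\ c_[p.+1] \in c by rewrite !mem_nth.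
have xy : c_[p] != c_[p.+1] by rewrite nth_uniq // neq_ltn ltnSn.
have Cxy : adj C c_[p] c_[p.+1] by rewrite Cadj xc yc next_nthS ?eqxx.
have Bp' : B c_[p.+1] by apply/AB.
have nBp : ~ B c_[p] by move=> /(AB _ xc).
split; [exists c_[p], [:: c_[p.+1]]|exists c_[p.+1], [:: c_[p]]];
  (split; first by split=> //=; rewrite ?inE ?andbT // ?[c_[p.+1] == _]eq_sym // adj_sym).
- split; apply/seteqP; split=> z /=; rewrite ?inE.
  + by case=> /orP[]/eqP->.
  + by move=> ->; rewrite eqxx.
  + by case=> /orP[]/eqP->.
  + by move=> ->; rewrite eqxx orbT.
split; apply/seteqP; split=> z /=; rewrite ?inE.
- by case=> /orP[]/eqP->.
- by move=> ->; rewrite eqxx.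
- by case=> /orP[]/eqP->.
- by move=> ->; rewrite eqxx orbT.
Qed.

(** Starting outside [A], the sequence would enter [A] before [i], leave it before [j] and enter it
    again before [k]: three distinct paths of one edge, where only two exist. *)
Lemma crossing_convex (A B : set V) i j k :
  (AB_paths C A B #= `I_2)%card \/ (AB_paths C B A #= `I_2)%card ->
  (forall x, x \in c -> B x <-> ~ A x) -> ~ A c_[0] ->
  (i < j)%N -> (j < k)%N -> (k < size c)%N ->
  A c_[i] -> A c_[k] -> A c_[j].
Proof.
move=> cAB AB A0 ij jk kc Ai Ak; apply: contrapT => Aj.
have BA x : x \in c -> A x <-> ~ B x.
  by move=> xc; rewrite AB //; split=> [Ax /(_ Ax)//|/contrapT].
have nB p : (p < size c)%N -> ~ A c_[p] <-> B c_[p].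
  by move=> pc; rewrite AB ?mem_nth.
have ic : (i < size c)%N by lia.
have [p1 [_ p1i nA1 A1]] :=
  @switch_index (fun p => ~ A c_[p]) 0%N i (leq0n i) A0 (fun h => h Ai).
have [p2 [ip2 p2j A2 nA2]] := @switch_index (fun p => A c_[p]) _ _ (ltnW ij) Ai Aj.
have [p3 [jp3 p3k nA3 A3]] :=
  @switch_index (fun p => ~ A c_[p]) j k (ltnW jk) Aj (fun h => h Ak).
move: A1 A3 => /contrapT A1 /contrapT A3.
have s1 : (p1.+1 < size c)%N by lia.
have s2 : (p2.+1 < size c)%N by lia.
have s3 : (p3.+1 < size c)%N by lia.
have [e1 e1'] := crossing_path s1 BA (proj1 (nB _ (ltnW s1)) nA1)
  (fun b => proj1 (AB _ (mem_nth _ s1)) b A1).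
have [e2 e2'] := crossing_path s2 AB A2 nA2.
have [e3 e3'] := crossing_path s3 BA (proj1 (nB _ (ltnW s3)) nA3)
  (fun b => proj1 (AB _ (mem_nth _ s3)) b A3).
have neq a b : (a < size c)%N -> (b < size c)%N -> (a < b)%N -> c_[a] <> c_[b].
  by move=> ac bc ab /eqP; rewrite nth_uniq // ltn_eqF.
(* Consecutive switches may share a vertex, so each pair of paths is told apart by whichever
   coordinate has different indices. *)
case: cAB => cAB.
  case: (card_two_three cAB e1' e2 e3') => -[].
  - by move=> _; apply: neq; lia.
  - by move=> h _; move: h; apply: neq; lia.
  - by move=> _; apply: neq; lia.
case: (card_two_three cAB e1 e2' e3) => -[].
- by move=> h _; move: h; apply: neq; lia.
- by move=> _; apply: neq; lia.
- by move=> h _; move: h; apply: neq; lia.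
Qed.

End CycleCrossing.

Section CycleSeq.
Context (V : choiceType) (G T : graph V) (v0 : V) (d : V -> nat)
  (par : V -> V) (F : set (set V)).
Context (TG : spanning T G) (rT : rooted T v0 d par) (tT : is_tree T).
Context (hcyc : forall T' : graph V, subgraph T' T -> is_tree T' ->
  finite_set (verts T') ->
  exists C' : graph V,
    [/\ subgraph C' G, is_cycle C', verts T' `<=` verts C' &
        forall e : set V, (F `&` edges T') e -> crosses C' T e 2]).
Local Notation D := (descendants T par).

(** All paths from [S] up to the root: a parent-closed set induces a subtree, and it contains the
    edge above each [v] in [S], to which the crossing hypothesis can then be applied. *)
Lemma finite_subtree (S : set V) : finite_set S -> S `<=` verts T ->
  exists T', [/\ subgraph T' T, is_tree T', finite_set (verts T'),
    verts T' v0 & forall v, S v -> v != v0 -> adj T' (par v) v].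
Proof.
move=> fS ST.
pose A := [set u | u = v0 \/ exists2 v, S v & exists2 k, (k <= d v)%N & iter k par v = u].
have AT : A `<=` verts T.
  move=> u [->|[v Sv [k _ <-]]]; first exact: (rooted_root rT).
  exact/(iter_par_verts rT)/ST.
have Apar u : A u -> A (par u).
  move=> [->|[v Sv [k kd <-]]]; first by rewrite (rooted_par0 rT); left.
  move: kd; rewrite leq_eqVlt => /predU1P[->|kd]; last first.
    by right; exists v => //; exists k.+1.
  left; rewrite (_ : iter (d v) par v = v0) ?(rooted_par0 rT) //.
  apply: (level_eq0 rT); first exact/(iter_par_verts rT)/ST.
  by rewrite (level_iter_par rT) ?subnn //; exact: ST.
have Tadj u : A u -> u != v0 -> adj (Defs.induced T A) (par u) u.
  move=> Au u0; rewrite /= (rooted_adj_par rT) ?mem_set //; last exact: AT.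
  exact: Apar.
exists (Defs.induced T A); split.
- by split=> [x []//|x y /andP[]].
- split; last by apply: subgraph_acyclic tT.2; split=> [x []//|x y /andP[]].
  have A0 : verts (Defs.induced T A) v0 by split; [exact: (rooted_root rT)|left].
  split; first by exists v0.
  suff H u : verts (Defs.induced T A) u -> linked (Defs.induced T A) v0 u.
    by move=> x y /H/linked_sym x0 /H; exact: linked_trans.
  move=> [_ Au]; move: {2}(d u) (leqnn (d u)) => n.
  elim: n u Au => [|n IH] u Au un.
    rewrite (level_eq0 rT (AT _ Au)); first exact: linked_refl.
    by apply/eqP; rewrite -leqn0.
  have [->|u0] := eqVneq u v0; first exact: linked_refl.
  apply: linked_trans (IH _ (Apar _ Au) _) _.
    by rewrite -ltnS -(rooted_levelS rT (AT _ Au) u0).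
  split; first exact: adj_verts (Tadj _ Au u0).
  by exists [:: u]; rewrite //= andbT; exact: Tadj.
- apply: (@sub_finite_set _ _
    ([set v0] `|` \bigcup_(v in S) ((fun k => iter k par v) @` `I_(d v).+1))).
    move=> u [_ [->|[v Sv [k kd <-]]]]; first by left.
    by right; exists v => //; exists k.
  rewrite finite_setU; split=> //; apply: bigcup_finite => // v _.
  exact/finite_image/finite_II.
- by split; [exact: (rooted_root rT)|left].
- by move=> v Sv v0'; apply: Tadj => //; right; exists v => //; exists 0%N.
Qed.

Lemma cycle_seq (S : set V) : finite_set S -> S `<=` verts T ->
  exists c : seq V, [/\ uniq c, (3 <= size c)%N, cycle (adj G) c,
    S `<=` [set` c] & [/\ v0 \in c, index v0 c = 0%N &
    forall v x y z, S v -> v != v0 -> F [set par v; v] -> z \in c ->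
      (index x c < index y c)%N -> (index y c < index z c)%N ->
      D v x -> D v z -> D v y]].
Proof.
move=> fS ST; have [||T' [T'T tT' fT' T'v0 T'S]] := @finite_subtree (v0 |` S).
- by rewrite finite_setU.
- by move=> x [->|/ST//]; exact: (rooted_root rT).
have [C [CG [c0 [uc0 c03 Cc0 Cadj0]] T'C CF]] := hcyc T'T tT' fT'.
have v0c0 : v0 \in c0 by have := T'C _ T'v0; rewrite Cc0.
(* Rotation moves [v0] to index 0 without changing [next]. *)
pose i := index v0 c0; pose c := rot i c0.
have uc : uniq c by rewrite rot_uniq.
have memc x : (x \in c) = (x \in c0) by rewrite mem_rot.
have c3 : (3 <= size c)%N by rewrite size_rot.
have Cadj x y : adj C x y =
    [&& x \in c, y \in c & (y == next c x) || (x == next c y)].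
  by rewrite Cadj0 !memc !next_rot.
have v0c : v0 \in c by rewrite memc.
have idx0 : index v0 c = 0%N.
  by rewrite /c /rot (drop_nth v0) ?index_mem // nth_index //= eqxx.
have Sc : S `<=` [set` c].
  move=> x Sx; rewrite /= memc; suff : verts C x by rewrite Cc0.
  apply: T'C; have [->//|x0] := eqVneq x v0.
  by apply: adj_vertsr (T'S x _ x0); right.
have cG x : x \in c -> verts G x by move=> xc; apply: CG.1; rewrite Cc0 /= -memc.
exists c; split=> //.
  apply: (@sub_in_cycle _ [in c] (frel (next c))) (cycle_next uc).
    by move=> x y xc yc /eqP <-; apply: CG.2; rewrite Cadj mem_next xc eqxx.
  exact/allP.
split=> // v x y z Sv vv0 Fv zc xy yz Dx Dz.
have Tv : verts T v by exact: ST.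
have [|T1 [T2 [T12 T1T2 T12c]]] := CF [set par v; v].
  split=> //; exists (par v), v; split=> //; apply: T'S => //; by right.
have [Dcomp Ecomp] := descendants_component rT Tv vv0.
set H := del_edges T _ in T12 Dcomp Ecomp.
have cD : components H (D v) by exists v => //; rewrite Dcomp.
have cE : components H (verts T `\` D v).
  by exists v0; [exact: (rooted_root rT)|rewrite Ecomp].
have DE : D v <> verts T `\` D v.
  by move=> h; have := descendants_refl par Tv; rewrite {1}h => -[_ []]; exact: descendants_refl.
(* The pair of components is unordered, so either one may be [D v]. *)
have cAB : (AB_paths C (D v) (verts T `\` D v) #= `I_2)%card \/
           (AB_paths C (verts T `\` D v) (D v) #= `I_2)%card.
  move: cD cE; rewrite T12 => -[]hD []hE; try by (case: DE; rewrite hE hD).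
    by left; rewrite hE hD.
  by right; rewrite hE hD.
have yc : y \in c by rewrite -index_mem (ltn_trans yz) // index_mem.
have xc : x \in c by rewrite -index_mem (ltn_trans xy) // index_mem.
rewrite -(nth_index v0 yc).
apply: (crossing_convex uc Cadj cAB _ _ xy yz); rewrite ?index_mem ?nth_index //.
- move=> w wc; split=> [[]//|nDw]; split=> //; rewrite TG.2; exact: cG.
- by have := nth_index v0 v0c; rewrite idx0 => ->; exact: (descendants_notroot rT).
Qed.

End CycleSeq.

(** * The limit order *)

(* [succ] is cyclic: the last vertex has successor [v0]. The sets in [conv] will
   be the vertex sets of the parts of T behind the edges of F. *)
Record limit_order (V : choiceType) (G : graph V) (v0 : V)
    (conv : set (set V)) (lt : V -> V -> Prop) (succ : V -> V) : Prop :=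
  LimitOrder {
  lim_irr : forall x, ~ lt x x ;
  lim_trans : forall x y z, lt x y -> lt y z -> lt x z ;
  lim_total : forall x y, verts G x -> verts G y -> x != y -> lt x y \/ lt y x ;
  lim_root : forall x, verts G x -> x != v0 -> lt v0 x ;
  lim_adj : forall x, verts G x -> adj G x (succ x) ;
  lim_succ : forall x, verts G x -> succ x != v0 ->
    lt x (succ x) /\ forall y, verts G y -> lt x y -> ~ lt y (succ x) ;
  lim_last : forall x, verts G x -> succ x = v0 ->
    forall y, verts G y -> ~ lt x y ;
  lim_pred : forall y, verts G y -> exists2 x, verts G x & succ x = y ;
  lim_succ2 : forall x, verts G x -> succ (succ x) != x ;
  lim_convex : forall B, conv B -> forall x y z,
    verts G y -> lt x y -> lt y z -> B x -> B z -> B y ;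
  lim_min : forall B, conv B -> exists2 m, B m & forall x, B x -> x != m -> lt m x ;
  lim_max : forall B, conv B -> exists2 m, B m & forall x, B x -> x != m -> lt x m }.

Lemma next_index (X : eqType) (c : seq X) x : uniq c -> x \in c ->
  index (next c x) c =
    if ((index x c).+1 < size c)%N then (index x c).+1 else 0%N.
Proof.
move=> uc xc; have x0 := x; case: ifPn => ic.
  by rewrite -{1}(nth_index x0 xc) next_nthS ?index_uniq.
case: c uc xc ic => // y c uc xc; rewrite next_nth xc -leqNgt => ic.
by rewrite nth_default //= eqxx.
Qed.

Lemma seq_argmax (X : eqType) (disp : Order.disp_t) (Y : orderType disp)
    (f : X -> Y) (s : seq X) x : x \in s ->
  exists2 m, m \in s & forall y, y \in s -> (f y <= f m)%O.
Proof.
elim: s x => // a s IH x _; case: s IH => [_|b s /(_ b (mem_head _ _))[m ms mM]].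
  by exists a; [exact: mem_head|move=> y; rewrite inE => /eqP->].
have [fa|fa] := leP (f a) (f m).
  exists m; first by rewrite inE ms orbT.
  by move=> y; rewrite inE => /orP[/eqP->|/mM].
exists a; first exact: mem_head.
by move=> y; rewrite inE => /orP[/eqP->//|/mM/le_trans]; apply; exact: ltW.
Qed.

(** * Limit of cyclic sequences along an ultrafilter *)

Section UltraLimit.
Context (V : choiceType) (G : graph V) (v0 : V) (conv : set (set V))
  (I : Type) (U : set_system I) (c : I -> seq V).
Context (UU : UltraFilter U) (lfG : locally_finite G).
Context (cP : forall i, [/\ uniq (c i), (3 <= size (c i))%N,
  cycle (adj G) (c i), v0 \in c i & index v0 (c i) = 0%N]).
Context (cG : forall x, verts G x -> U [set i | x \in c i]).
Context (cconv : forall B, conv B -> U [set i | forall x y z, z \in c i ->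
  (index x (c i) < index y (c i))%N -> (index y (c i) < index z (c i))%N ->
  B x -> B z -> B y]).
Context (convG : forall B, conv B -> [/\ B `<=` verts G, B !=set0, ~ B v0 &
  finite_set [set x | B x /\ exists2 y, ~ B y & adj G x y]]).
Implicit Types (x y z : V) (B : set V).

Let lt x y := U [set i | (index x (c i) < index y (c i))%N].

(** The source of every vertex of the limit: a choice among finitely many vertices is constant along
    [U]. Finiteness comes from local finiteness or from a finite cut. *)
Let ultra_value (f : I -> V) (A : set V) : finite_set A ->
  U [set i | A (f i)] -> exists2 a, A a & U [set i | f i = a].
Proof.
move=> fA UA; apply: (ultra_bigcup_finite (B := fun a => [set i | f i = a])) => //.
by apply: filterS UA => i Ai; exists (f i).
Qed.

Let next_adj i x : x \in c i -> adj G x (next (c i) x).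
Proof. by move=> xc; have [_ _ cc _ _] := cP i; exact: next_cycle cc xc. Qed.

Let uex (P : set I) : U P -> exists i, P i.
Proof. exact: filter_ex. Qed.

Let next_ultra x : verts G x ->
  exists2 y, adj G x y & U [set i | next (c i) x = y].
Proof.
move=> Gx; apply: (ultra_value (lfG Gx)).
by apply: filterS (cG Gx) => i; exact: next_adj.
Qed.

Let succ x := xget x [set y | U [set i | next (c i) x = y]].

Let succP x : verts G x -> U [set i | next (c i) x = succ x].
Proof.
move=> Gx; have [y _ yU] := next_ultra Gx.
exact: (@xgetI _ x [set y | U [set i | next (c i) x = y]] y yU).
Qed.

Let succ_eq x y : U [set i | next (c i) x = y] -> verts G x -> succ x = y.
Proof.
move=> Uy Gx; have [i [/= <- <-]] := uex (filterI (succP Gx) Uy).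
by [].
Qed.

Let nextE i x : x \in c i -> next (c i) x != v0 ->
  index (next (c i) x) (c i) = (index x (c i)).+1.
Proof.
have [uc c3 cc vc v0i] := cP i; move=> xc nx; rewrite next_index //.
case: ifPn => // ic; case/eqP: nx.
have nc : next (c i) x \in c i by rewrite mem_next.
by rewrite -(nth_index v0 nc) next_index // (negbTE ic) -v0i nth_index.
Qed.

Let boundary B i x y : conv B -> B x -> ~ B y -> x \in c i -> y \in c i ->
  y = next (c i) x \/ x = next (c i) y ->
  [set x | B x /\ exists2 y, ~ B y & adj G x y] x.
Proof.
move=> cB Bx nBy xc yc xy; split=> //; exists y => //.
by case: xy => ->; [|rewrite adj_sym]; exact: next_adj.
Qed.

(** In each cycle the maximiser lies on the finite cut of [B], so along [U] it is one fixed vertex.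
    The function [f] is a parameter in order to get the last vertex from the index and the first one
    from its complement. *)
Let extremum B (f : I -> V -> nat) : conv B ->
  (forall i m, m \in c i -> B m ->
     (forall x, x \in c i -> B x -> (f i x <= f i m)%N) ->
     [set x | B x /\ exists2 y, ~ B y & adj G x y] m) ->
  exists2 m, B m & forall x, B x -> U [set i | (f i x <= f i m)%N].
Proof.
move=> cB fB; have [BG [b Bb] nB0 finB] := convG cB.
have h i : exists m, b \in c i -> [/\ m \in c i, B m &
    forall x, x \in c i -> B x -> (f i x <= f i m)%N].
  have [bc|] := boolP (b \in c i); last by exists b.
  have : b \in [seq x <- c i | x \in B] by rewrite mem_filter mem_set.
  move=> /(seq_argmax (f i))[m]; rewrite mem_filter => /andP[/set_mem Bm mc] mM.
  by exists m => _; split=> // x xc Bx; apply: mM; rewrite mem_filter mem_set.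
have [g gP] := boolp.choice h.
have [|m Bm Um] := ultra_value (f := g) finB.
  apply: filterS (cG (BG _ Bb)) => i bc; have [gc Bg gM] := gP i bc.
  exact: fB gM.
exists m; first by case: Bm.
move=> x Bx; apply: filterS (filterI Um (filterI (cG (BG _ Bx)) (cG (BG _ Bb)))).
by move=> i [/= <- [xc bc]]; have [_ _] := gP i bc; exact.
Qed.

Lemma ultra_limit_order : exists lt succ, limit_order G v0 conv lt succ.
Proof.
exists lt, succ.
have total x y : verts G x -> verts G y -> x != y -> lt x y \/ lt y x.
  move=> Gx Gy xy.
  have [|nxy] := in_ultra_setVsetC [set i | (index x (c i) < index y (c i))%N] UU.
    by left.
  right; apply: filterS (filterI nxy (filterI (cG Gx) (cG Gy))) => i [/=].
  move=> /negP; rewrite -leqNgt leq_eqVlt => /orP[/eqP yx [xc yc]|//].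
  by move: xy; rewrite -(nth_index v0 xc) -(nth_index v0 yc) yx eqxx.
split.
- by move=> x /uex[i /=]; rewrite ltnn.
- move=> x y z xy yz; apply: filterS (filterI xy yz) => i [/=]; exact: ltn_trans.
- exact: total.
- move=> x Gx x0; apply: filterS (cG Gx) => i /= xc; have [_ _ _ vc v0i] := cP i.
  rewrite v0i lt0n; apply: contra_neq x0 => xi.
  by rewrite -(nth_index v0 xc) xi -v0i nth_index.
- move=> x Gx; have [i [/= xc <-]] := uex (filterI (cG Gx) (succP Gx)).
  exact: next_adj.
- move=> x Gx sx0; split.
    apply: filterS (filterI (cG Gx) (succP Gx)) => i [/= xc sE].
    by rewrite -sE nextE // sE.
  move=> y Gy xy ys.
  have [i [/= [xc sE] [xy' ys']]] :=
    uex (filterI (filterI (cG Gx) (succP Gx)) (filterI xy ys)).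
  by move: ys'; rewrite -sE nextE ?sE //; move: xy' => /=; lia.
- move=> x Gx sx0 y Gy xy.
  have [i [/= [xc sE] [/= xy' yc]]] :=
    uex (filterI (filterI (cG Gx) (succP Gx)) (filterI xy (cG Gy))).
  have [uc c3 cc vc v0i] := cP i.
  have := next_index uc xc; rewrite sE sx0 v0i; case: ifPn => // + _.
  by move: yc; rewrite -index_mem; move: xy' => /=; lia.
- move=> y Gy; have [|x yx Ux] := ultra_value (f := fun i => prev (c i) y) (lfG Gy).
    apply: filterS (cG Gy) => i /= yc; have [_ _ cc _ _] := cP i.
    by rewrite adj_sym; exact: prev_cycle cc yc.
  exists x; first exact: adj_vertsr yx.
  apply: succ_eq (adj_vertsr yx); apply: filterS Ux => i /= <-.
  by have [uc _ _ _ _] := cP i; exact: next_prev.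
(* Two steps along a cycle of length at least three never return; later this prevents an edge from
   being traversed twice. *)
- move=> x Gx; apply/eqP => sx.
  have Gsx : verts G (succ x).
    have [i [/= xc <-]] := uex (filterI (cG Gx) (succP Gx)).
    exact: adj_vertsr (next_adj xc).
  have [i [/= xc [s1 s2]]] :=
    uex (filterI (cG Gx) (filterI (succP Gx) (succP Gsx))).
  have [uc c3 cc vc v0i] := cP i.
  have nc : next (c i) x \in c i by rewrite mem_next.
  have i1 := next_index uc xc; have := next_index uc nc.
  move: s1 s2 => /= s1 s2; rewrite {1}s1 s2 sx i1.
  have : (index x (c i) < size (c i))%N by rewrite index_mem.
  by do ! case: ifPn => //=; lia.
- move=> B cB x y z Gy xy yz Bx Bz; have [BG _ _ _] := convG cB.
  have [i [[xy' yz'] [zc cc]]] :=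
    uex (filterI (filterI xy yz) (filterI (cG (BG _ Bz)) (cconv cB))).
  exact: cc zc xy' yz' Bx Bz.
- move=> B cB; have [BG _ nB0 _] := convG cB.
  have [i m mc Bm mM|m Bm mM] :=
      @extremum B (fun i x => (size (c i) - index x (c i))%N) cB.
    have [uc c3 cc vc v0i] := cP i.
    have pc : prev (c i) m \in c i by rewrite mem_prev.
    have nE : next (c i) (prev (c i) m) = m by rewrite next_prev.
    apply: (boundary (i := i) (y := prev (c i) m)) => //; last by right.
    (* Since [B] misses [v0], there is no wrap-around: the predecessor has index one less, against
       minimality. *)
    move=> Bp; have := mM _ pc Bp; have := nextE pc; rewrite nE.
    have -> : m != v0 by apply/eqP => m0; rewrite m0 in Bm.
    by move=> /(_ isT); have : (index m (c i) < size (c i))%N;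
      [rewrite index_mem|lia].
  exists m => // x Bx xm; case: (total x m) => //; try exact: BG.
  move=> xm'.
  have [i [/= xi [xm'' mc]]] := uex (filterI (mM x Bx) (filterI xm' (cG (BG _ Bm)))).
  have mi : (index m (c i) < size (c i))%N by rewrite index_mem.
  by exfalso; lia.
move=> B cB; have [BG _ nB0 _] := convG cB.
have [i m mc Bm mM|m Bm mM] := @extremum B (fun i x => index x (c i)) cB.
  have nc : next (c i) m \in c i by rewrite mem_next.
  apply: (boundary (i := i) (y := next (c i) m)) => //; last by left.
  move=> Bn; have := mM _ nc Bn; rewrite nextE ?ltnn //.
  by apply/eqP => n0; rewrite n0 in Bn.
exists m => // x Bx xm; case: (total x m) => //; try exact: BG.
move=> mx; have [i [/= xi mx']] := uex (filterI (mM x Bx) mx).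
by exfalso; move: mx' => /=; lia.
Qed.

End UltraLimit.

(** * Laying out the order along a segment *)

(** The element numbered [n] weighs two to the power [-(n+1)], and [mu] sums the weights over [A]
    intersected with [K]. Smallness off a finite set stands in for countable additivity. *)
Lemma countable_weights (R : realType) (X : Type) (K : set X) : countable K ->
  exists (w : X -> R) (mu : set X -> R),
  [/\ forall x, 0 < w x,
      forall x, K x -> mu [set x] = w x,
      forall A B, A `<=` B -> mu A <= mu B,
      forall A B, A `&` B = set0 -> mu (A `|` B) = mu A + mu B &
      forall e, 0 < e -> exists S, [/\ finite_set S, S `<=` K &
        forall A, A `<=` K -> A `&` S = set0 -> mu A < e]].
Proof.
move=> /countable_injP[i iinj].
pose h n : R := 2^-1 ^+ n.
have h0 n : 0 < h n by rewrite exprn_gt0 // invr_gt0.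
have hS n : h n = h n.+1 + h n.+1 by rewrite /h exprSr; lra.
pose t (A : set X) n : R := if `[< exists x, [/\ A x, K x & i x = n] >] then h n.+1 else 0.
have t0 A n : 0 <= t A n by rewrite /t; case: asboolP => // _; exact: ltW.
have th A n : t A n <= h n.+1 by rewrite /t; case: asboolP => // _; exact: ltW.
(* The extra term makes the induction telescope: it is the part of the geometric tail not yet
   summed. *)
have tail A N k : (forall n, (n < N)%N -> t A n = 0) ->
    series (t A) k + h (maxn k N) <= h N.
  move=> A0; elim: k => [|k IH].
    by rewrite seriesEnat /= big_geq // max0n add0r.
  rewrite seriesEnat /= big_nat_recr //= -[X in X + _ + _]/(series (t A) k).
  have [kN|Nk] := ltnP k N.
    by rewrite A0 // addr0; move: IH; rewrite (maxn_idPr (ltnW kN)) (maxn_idPr kN).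
  move: IH; rewrite (maxn_idPl Nk) (maxn_idPl (leqW Nk)) [h k]hS.
  by have := th A k; lra.
have tail' A N k : (forall n, (n < N)%N -> t A n = 0) -> series (t A) k <= h N.
  by move=> /(tail A N k); have := h0 (maxn k N); lra.
have cv A : cvgn (series (t A)).
  apply: nondecreasing_is_cvgn; first by
    apply/nondecreasing_seqP => n; rewrite !seriesEnat /= big_nat_recr //= lerDl.
  by exists (h 0%N) => _ [k _ <-]; exact: tail'.
pose mu A := limn (series (t A)).
have muh A N : (forall n, (n < N)%N -> t A n = 0) -> mu A <= h N.
  by move=> A0; apply: limr_le => //; apply: nearW => k; exact: tail'.
exists (fun x => h (i x).+1), mu; split.
- by [].
- move=> x Kx; apply: cvg_lim => //; apply: (@cvg_near_cst) => //.
  near=> k; rewrite seriesEnat /= (bigD1_seq (i x)) ?iota_uniq //=; last first.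
    by rewrite mem_index_iota /=; near: k; exists (i x).+1.
  rewrite big1 ?addr0 /t; last first.
    move=> n nx; case: asboolP => // -[y [/= -> _ xn]].
    by rewrite xn eqxx in nx.
  by case: asboolP => // -[]; exists x.
- move=> A B AB; apply: ler_lim => //; apply: nearW => k.
  rewrite !seriesEnat /=; apply: ler_sum => n _; rewrite /t.
  case: asboolP => [[x [Ax Kx xn]]|_]; last by case: asboolP => // _; exact: ltW.
  by case: asboolP => // -[]; exists x; split=> //; exact: AB.
- move=> A B AB; rewrite /mu -limD //; congr (limn _); apply/funext => k.
  transitivity (series (t A) k + series (t B) k); last by [].
  rewrite !seriesEnat /= -big_split /=; apply: eq_bigr => n _; rewrite /t.
  case: asboolP => [[x [ABx Kx xn]]|nAB]; case: asboolP => [[y [Ay Ky yn]]|nA];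
    case: asboolP => [[z [Bz Kz zn]]|nB]; rewrite ?addr0 ?add0r //.
  + suff : (set0 : set X) y by []; rewrite -AB; split=> //.
    by rewrite (iinj y z) ?mem_set //; rewrite yn zn.
  + by case: ABx => h'; [case: nA|case: nB]; exists x.
  + by case: nAB; exists y; split=> //; left.
  + by case: nAB; exists y; split=> //; left.
  + by case: nAB; exists z; split=> //; right.
move=> e e0.
have [N hN] : exists N, h N < e.
  have := @cvg_expr R 2^-1; rewrite ger0_norm; last by lra.
  have -> : 2^-1 < 1 :> R by lra.
  move=> /(_ isT)/cvgrPdist_lt/(_ e e0)[N _ /(_ N (leqnn N))].
  by rewrite /= sub0r normrN gtr0_norm //; exists N.
exists [set x | K x /\ (i x < N)%N]; split.
- apply: (@sub_finite_set _ _
    (\bigcup_(n in `I_N) [set x | K x /\ i x = n])).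
    by move=> x [Kx xN]; exists (i x).
  apply: bigcup_finite => [|n _]; first exact: finite_II.
  have [[x [Kx xn]]|nx] := pselect (exists x, K x /\ i x = n).
    apply: sub_finite_set (finite_set1 x) => y [Ky yn] /=.
    by apply: iinj; rewrite ?mem_set // yn xn.
  by apply: sub_finite_set (@finite_set0 X) => y [Ky yn]; apply: nx; exists y.
- by move=> x [].
move=> A AK AS; apply: le_lt_trans hN; apply: muh => n nN.
rewrite /t; case: asboolP => // -[x [Ax Kx xn]].
suff : (set0 : set X) x by []; rewrite -AS; split=> //; split=> //.
by rewrite xn.
Unshelve. all: end_near.
Qed.

Section LinePosition.
Context (R : realType) (V : choiceType) (G : graph V) (v0 : V)
  (conv : set (set V)) (lt : V -> V -> Prop) (succ : V -> V).
Context (LO : limit_order G v0 conv lt succ) (Gv0 : verts G v0).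
Context (w : V -> R) (mu : set V -> R).
Context (w0 : forall x, 0 < w x)
  (mu1 : forall x, verts G x -> mu [set x] = w x)
  (muS : forall A B, A `<=` B -> mu A <= mu B)
  (muU : forall A B, A `&` B = set0 -> mu (A `|` B) = mu A + mu B)
  (mu_small : forall e, 0 < e -> exists S, [/\ finite_set S, S `<=` verts G &
     forall A, A `<=` verts G -> A `&` S = set0 -> mu A < e]).
Implicit Types (x y z : V) (s : R).

Definition below x : set V := [set u | verts G u /\ lt u x].
Definition position x : R := mu (below x).
Definition total_length : R := mu (verts G).
Local Notation g := position.
Local Notation W := total_length.

(* The points of [0, W] that no edge covers; they become ends. *)
Definition gap s : Prop :=
  0 <= s <= W /\ forall x, verts G x -> ~ (g x <= s <= g x + w x).

Lemma mu0 : mu set0 = 0.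
Proof. by have := muU (setIid set0); rewrite setUid; lra. Qed.

Lemma mu_ge0 A : 0 <= mu A.
Proof. by rewrite -mu0; exact: muS. Qed.

Lemma mu_split A B : mu A = mu (A `&` B) + mu (A `\` B).
Proof.
rewrite -muU; last by rewrite setDE setIACA setICr setI0.
by congr mu; rewrite setDE -setIUr setUv setIT.
Qed.

Lemma lim_asym x y : lt x y -> ~ lt y x.
Proof. by move=> xy /(lim_trans LO xy)/(lim_irr LO). Qed.

Lemma position_ge0 x : 0 <= g x. Proof. exact: mu_ge0. Qed.

Lemma position_add x : verts G x -> g x + w x = mu (below x `|` [set x]).
Proof.
move=> Gx; rewrite muU ?mu1 //; apply/seteqP; split=> // u [[_ ux] xu].
by rewrite xu in ux; case: (lim_irr LO ux).
Qed.

Lemma position_lt x y : verts G x -> lt x y -> g x + w x <= g y.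
Proof.
move=> Gx xy; rewrite position_add //; apply: muS => u [[Gu ux]|->] //.
by split=> //; exact: (lim_trans LO ux xy).
Qed.

Lemma position_mono x y : verts G x -> lt x y -> g x < g y.
Proof. by move=> Gx /(position_lt Gx); have := w0 x; lra. Qed.

Lemma position_root : g v0 = 0.
Proof.
rewrite /g (_ : below v0 = set0) ?mu0 //; apply/seteqP; split=> // u [Gu uv].
have [uv0|uv0] := eqVneq u v0; first by rewrite uv0 in uv; case: (lim_irr LO uv).
by case: (lim_asym uv); exact: (lim_root LO).
Qed.

Lemma position_le x : verts G x -> g x + w x <= W.
Proof. by move=> Gx; rewrite position_add //; apply: muS => u [[]|->]. Qed.

Lemma position_cmp x y : verts G x -> verts G y -> g x < g y -> lt x y.
Proof.
move=> Gx Gy xy; have [xE|nxy] := eqVneq x y; first by rewrite xE ltxx in xy.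
by case: (lim_total LO Gx Gy nxy) => // /(position_mono Gy); lra.
Qed.

Lemma position_succ x : verts G x -> succ x != v0 -> g (succ x) = g x + w x.
Proof.
move=> Gx sx0; rewrite position_add //; congr mu; apply/seteqP.
have [xs ns] := lim_succ LO Gx sx0; split=> u.
  move=> [Gu us]; have [->|ux] := eqVneq u x; first by right.
  by case: (lim_total LO Gu Gx ux) => [ux'|/ns]; [left|case].
by case=> [[Gu ux]|->]; split=> //; exact: (lim_trans LO ux xs).
Qed.

Lemma position_last x : verts G x -> succ x = v0 -> g x + w x = W.
Proof.
move=> Gx sx0; rewrite position_add //; congr mu; apply/seteqP; split=> u.
  by case=> [[]|->].
move=> Gu; have [->|ux] := eqVneq u x; first by right.
by case: (lim_total LO Gu Gx ux) => [|/(lim_last LO Gx sx0 Gu)//]; left.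
Qed.

Lemma total_length_gt0 : 0 < W.
Proof. by have := position_le Gv0; have := w0 v0; rewrite position_root; lra. Qed.

(** If [y] came later than [succ x], the interval of [succ x], of positive length, would separate
    the two. *)
Lemma position_overlap x y s : verts G x -> verts G y -> lt x y ->
  g x <= s <= g x + w x -> g y <= s <= g y + w y ->
  [/\ y = succ x, y != v0, s = g y & s = g x + w x].
Proof.
move=> Gx Gy xy sx sy; have xy' := position_lt Gx xy.
have sx0 : succ x != v0.
  by apply/eqP => /(lim_last LO Gx)/(_ y Gy)/(_ xy).
have [xs ns] := lim_succ LO Gx sx0; have sE := position_succ Gx sx0.
have Gs : verts G (succ x) by exact: adj_vertsr (lim_adj LO Gx).
have yE : y = succ x.
  apply: contrapT => /eqP/(lim_total LO Gy Gs)[]; first exact: ns.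
  by move=> /(position_mono Gs); lra.
by split=> //; [rewrite yE|lra|lra].
Qed.

(** A covered point at the right end of its interval is passed on to the next one. The half-open
    form gives an edge to the right of [s] and an edge parameter below 1. *)
Lemma not_gap_right s : 0 <= s < W -> ~ gap s ->
  exists2 x, verts G x & g x <= s < g x + w x.
Proof.
move=> sW ng; have [x [Gx sx]] : exists x, verts G x /\ g x <= s <= g x + w x.
  apply: contrapT => nx; apply: ng; split; first by lra.
  by move=> x Gx sx; apply: nx; exists x.
have [slt|sge] := ltP s (g x + w x); first by exists x => //; lra.
have sx0 : succ x != v0 by apply/eqP => /(position_last Gx); lra.
exists (succ x); first exact: adj_vertsr (lim_adj LO Gx).
by rewrite position_succ //; have := w0 (succ x); lra.
Qed.

Lemma not_gap_left s : 0 < s <= W -> ~ gap s ->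
  exists2 x, verts G x & g x < s <= g x + w x.
Proof.
move=> sW ng; have [x [Gx sx]] : exists x, verts G x /\ g x <= s <= g x + w x.
  apply: contrapT => nx; apply: ng; split; first by lra.
  by move=> x Gx sx; apply: nx; exists x.
have [slt|sge] := ltP (g x) s; first by exists x => //; lra.
have x0 : x != v0.
  by apply/eqP => x0; move: sge; rewrite x0 position_root; lra.
have [y Gy yx] := lim_pred LO Gx; exists y => //.
by move: sge sx; rewrite -yx position_succ ?yx //; have := w0 y; lra.
Qed.

Lemma gap_dense s e : gap s -> 0 < e ->
  exists2 x, verts G x & s < g x < s + e.
Proof.
move=> [sW sgap] e0.
pose L := [set u | verts G u /\ g u < s].
have LS u : L u -> g u + w u < s.
  by move=> [Gu us]; rewrite ltNge; apply/negP => su; apply: (sgap _ Gu); lra.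
have US u : verts G u -> ~ L u -> s < g u.
  move=> Gu nLu; rewrite ltNge; apply/negP => us; apply: nLu; split=> //.
  rewrite lt_neqAle us andbT; apply/eqP => su; apply: (sgap _ Gu).
  by have := w0 u; lra.
(* Up to an arbitrarily small rest [L] is finite, and a finite part weighs at most what lies up to
   its rightmost vertex, whose interval ends before [s]. *)
have muL : mu L <= s.
  rewrite leNgt; apply/negP => sL.
  have [S [fS SG Ssmall]] : exists S, [/\ finite_set S, S `<=` verts G &
      forall A, A `<=` verts G -> A `&` S = set0 -> mu A < mu L - s].
    by apply: mu_small; lra.
  have LE := mu_split L S.
  have small : mu (L `\` S) < mu L - s.
    by apply: Ssmall; [move=> u [[]]|rewrite setDE -setIA setICl setI0].
  suff : mu (L `&` S) <= s by lra.
  have [t tE] := (finite_seqP (L `&` S)).1 (sub_finite_set (@subIsetr _ L S) fS).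
  have [t0|[x tx]] : t = [::] \/ exists x, x \in t.
    by case: (t) => [|x t']; [left|right; exists x; exact: mem_head].
    by rewrite tE t0 set_nil mu0; case/andP: sW.
  have [m mt mM] := seq_argmax g tx.
  have [Lm Sm] : (L `&` S) m by rewrite tE.
  apply: le_trans (ltW (LS _ Lm)); have [Gm _] := Lm.
  rewrite position_add //; apply: muS => u; rewrite tE => /= ut.
  have [Lu _] : (L `&` S) u by rewrite tE.
  have [->|um] := eqVneq u m; first by right.
  have [Gu _] := Lu; case: (lim_total LO Gu Gm um); first by left.
  by move=> /(position_mono Gm) mu'; exfalso; have := mM _ ut; lra.
have [S [fS SG Ssmall]] := mu_small e0.
have [l Gl lE] := lim_pred LO Gv0.
have nLl : ~ L l.
  by move=> /LS; have := position_last Gl lE; case/andP: sW; lra.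
(* The leftmost vertex of [P] is close to [s]: what precedes it outside [L] avoids [S] and weighs
   less than [e]. The last vertex [l] keeps [P] nonempty. *)
pose P := l |` (S `\` L).
have [t tE] : exists t : seq V, P = [set` t].
  apply/finite_seqP; rewrite finite_setU; split=> //.
  exact: sub_finite_set (@subDsetl _ S L) fS.
have lt_ : l \in t by have : P l by [left]; rewrite tE.
have [m mt mM] := seq_argmax (fun u => - g u) lt_.
have [Gm nLm] : verts G m /\ ~ L m.
  have : P m by rewrite tE.
  by case=> [->|[/SG Gm nLm]].
exists m => //; rewrite US //=.
have gm : g m = mu (below m `&` L) + mu (below m `\` L) := mu_split _ L.
have h1 : mu (below m `&` L) <= mu L by apply: muS => u [].
have h2 : mu (below m `\` L) < e.
  apply: Ssmall; first by move=> u [[]].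
  apply/seteqP; split=> // u [[[Gu um] nLu] Su].
  have : u \in t by have : P u by [right]; rewrite tE.
  by move=> /mM gmu; exfalso; have := position_mono Gu um; lra.
lra.
Qed.

Lemma gap_position_neq s x : gap s -> verts G x -> g x != s.
Proof.
by move=> [_ sg] Gx; apply/eqP => gx; apply: (sg x Gx); have := w0 x; lra.
Qed.

Lemma gap_ultra s : gap s -> exists U : set_system V,
  [/\ UltraFilter U, U (verts G), forall x, ~ U [set x] &
      forall e, 0 < e -> U [set x | verts G x /\ s < g x < s + e]].
Proof.
move=> gs; pose F0 : set_system V := [set B | exists2 e, 0 < e &
  [set x | verts G x /\ s < g x < s + e] `<=` B].
have F0F : ProperFilter F0.
  apply: Build_ProperFilter_ex.
    move=> B [e e0 eB]; have [x Gx xs] := gap_dense gs e0.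
    by exists x; apply: eB.
  split.
  - by exists 1.
  - move=> A B [e e0 eA] [e' e'0 e'B]; exists (Num.min e e').
      by rewrite lt_min e0.
    move=> x [Gx /andP[sx xe]]; split; [apply: eA|apply: e'B]; split=> //; rewrite sx /=;
      by apply: lt_le_trans xe _; rewrite lerD2l ge_min lexx ?orbT.
  - by move=> A B AB [e e0 eA]; exists e => //; exact: subset_trans AB.
have [U [UU F0U]] := ultraFilterLemma F0F.
have Ue e : 0 < e -> U [set x | verts G x /\ s < g x < s + e].
  by move=> e0; apply: F0U; exists e.
exists U; split=> //; first by apply: filterS (Ue 1 ltr01) => x [].
move=> x Ux; have [sx|xs] := ltP s (g x).
  have [|y [-> []]] := filter_meet _ Ux (Ue (g x - s) _); first by lra.
  by move=> _; lra.
by have [y [-> [_]]] := filter_meet _ Ux (Ue 1 ltr01); lra.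
Qed.

End LinePosition.

(** * The circle *)

Section Circle.
Context (R : realType) (V : choiceType) (G T : graph V) (v0 : V) (d : V -> nat)
  (par : V -> V).
Context (lfG : locally_finite G) (TG : spanning T G) (fT : faithful T G)
  (rT : rooted T v0 d par).
Context (conv : set (set V)) (lt : V -> V -> Prop) (succ : V -> V)
  (LO : limit_order G v0 conv lt succ).
Context (convD : forall r, rooted_ray T v0 par r ->
  forall N, exists n, (N <= n)%N /\ conv (descendants T par (r n))).
Context (w : V -> R) (mu : set V -> R).
Context (w0 : forall x, 0 < w x)
  (mu1 : forall x, verts G x -> mu [set x] = w x)
  (muS : forall A B, A `<=` B -> mu A <= mu B)
  (muU : forall A B, A `&` B = set0 -> mu (A `|` B) = mu A + mu B)
  (mu_small : forall e, 0 < e -> exists S, [/\ finite_set S, S `<=` verts G &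
     forall A, A `<=` verts G -> A `&` S = set0 -> mu A < e]).
Implicit Types (x y z u v : V) (s : R) (r : nat -> V).
Local Notation D := (descendants T par).
Local Notation g := (position G lt mu).
Local Notation W := (total_length G mu).
Local Notation gap := (gap G lt w mu).

Let Gv0 : verts G v0. Proof. by apply: TG.1.1; exact: (rooted_root rT). Qed.

Let mono x y : verts G x -> lt x y -> g x < g y.
Proof. exact: (position_mono LO w0 mu1 muS muU). Qed.

Let cmp x y : verts G x -> verts G y -> g x < g y -> lt x y.
Proof. exact: (position_cmp LO w0 mu1 muS muU). Qed.

(** The trace that the ultrafilter at [s] leaves on its ray; the ultrafilter itself is then
    dropped. *)
Definition gap_ray s r : Prop := rooted_ray T v0 par r /\
  forall n e, 0 < e -> exists2 x, D (r n) x & s < g x < s + e.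

Lemma gap_ray_exists s : gap s -> exists r, gap_ray s r.
Proof.
move=> gs; have [U [UU UG U1 Us]] :=
  gap_ultra LO Gv0 w0 mu1 muS muU mu_small gs.
have [r [rr Ur]] := ultra_ray lfG TG rT UU UG U1.
exists r; split=> // n e e0.
by have [x [Dx [_ xs]]] := filter_meet _ (Ur n) (Us e e0); exists x.
Qed.

Let DG v u : D v u -> verts G u.
Proof. by case=> Tu _; exact: TG.1.1. Qed.

(** Members of [D (r n)] approach [s] from the right, so the first one cannot lie beyond [s] and the
    last one must; a gap is never the position of a vertex, so both inequalities are strict. *)
Lemma gap_ray_interval s r n : gap s -> gap_ray s r -> conv (D (r n)) ->
  exists m M, [/\ D (r n) m, D (r n) M, g m < s < g M &
    forall x, verts G x -> D (r n) x <-> g m <= g x <= g M].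
Proof.
move=> gs [rr rs] cD.
have [m Dm mP] := lim_min LO cD; have [M DM MP] := lim_max LO cD.
exists m, M; split=> //.
  apply/andP; split.
    rewrite ltNge; apply/negP => sm.
    have ms : g m != s := gap_position_neq w0 gs (DG Dm).
    have [|x Dx xs] := rs n (g m - s); first by lra.
    have [xm|/(mP _ Dx)/(mono (DG Dm))] := eqVneq x m; last by lra.
    by rewrite xm in xs; lra.
  have [x Dx xs] := rs n 1 ltr01.
  have [xM|/(MP _ Dx)/(mono (DG Dx))] := eqVneq x M; last by lra.
  by rewrite -xM; lra.
move=> x Gx; split=> [Dx|mxM].
  apply/andP; split.
    by have [->//|/(mP _ Dx)/(mono (DG Dm))/ltW] := eqVneq x m.
  by have [->//|/(MP _ Dx)/(mono Gx)/ltW] := eqVneq x M.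
have [->//|xm] := eqVneq x m; have [->//|xM] := eqVneq x M.
apply: (lim_convex LO cD Gx _ _ Dm DM).
  by case: (lim_total LO (DG Dm) Gx); rewrite 1?eq_sym // => /(mono Gx); lra.
by case: (lim_total LO Gx (DG DM) xM) => // /(mono (DG DM)); lra.
Qed.

(** A vertex [v] between the gaps lies in every interval around both, hence in [D (r n)] for some
    [n] above the level of [v]. *)
Lemma gap_ray_inj s s' r : gap s -> gap s' -> gap_ray s r -> gap_ray s' r ->
  ~ s < s'.
Proof.
move=> gs gs' rs rs' ss'.
have [|v Gv vs] := gap_dense LO Gv0 w0 mu1 muS muU mu_small gs (e := s' - s).
  by lra.
have [rr _] := rs; have [n [nv cD]] := convD rr (d v).+1.
have [m [M [Dm DM ms DP]]] := gap_ray_interval gs rs cD.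
have [m' [M' [_ DM' ms' _]]] := gap_ray_interval gs' rs' cD.
have Dv : D (r n) v.
  by apply/DP => //; have := (DP _ (DG DM')).1 DM'; lra.
have [+ _] := descendants_iter rT Dv.
by rewrite (rooted_ray_level rT) //; lia.
Qed.

(** A relation, since [x] is ambiguous where two edge intervals meet, and the ray at a gap is only
    known to exist. *)
Definition circle_at s (p : freudenthal R G) : Prop :=
  (exists x q, [/\ verts G x, g x <= s <= g x + w x, p = ComplexPt q &
     \val q = edge_pt x (succ x) ((s - g x) / w x)]) \/
  (gap s /\ exists r e, [/\ gap_ray s r, p = EndPt R e & \val e = end_of G r]).

Let unit_param s x : g x <= s <= g x + w x -> 0 <= (s - g x) / w x <= 1.
Proof.
move=> sx; apply/andP; split; last by rewrite ler_pdivrMr // mul1r; lra.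
by apply: divr_ge0; [lra|exact: ltW].
Qed.

Let ray_end r : ray G r -> ends G (end_of G r).
Proof. by move=> rG; exists r. Qed.

Let gap_ray_G s r : gap_ray s r -> ray G r.
Proof. by move=> [rr _]; apply: (subgraph_ray TG); exact: (rooted_ray_ray rT rr). Qed.

Lemma circle_at_exists s : 0 <= s <= W -> exists p, circle_at s p.
Proof.
move=> sW; have [gs|ng] := pselect (gap s).
  have [r rs] := gap_ray_exists gs.
  pose e : set_type (ends G) := exist _ (end_of G r) (mem_set (ray_end (gap_ray_G rs))).
  by exists (EndPt R e); right; split=> //; exists r, e.
have [x [Gx sx]] : exists x, verts G x /\ g x <= s <= g x + w x.
  by apply: contrapT => nx; apply: ng; split=> // x Gx sx; apply: nx; exists x.
exists (ComplexPt (complex_point (complex_edge_pt (lim_adj LO Gx) (unit_param sx)))).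
by left; exists x; eexists; split.
Qed.

Context (phi : R -> freudenthal R G)
  (phiP : forall s, 0 <= s <= W -> circle_at s (phi s)).

(** Where two intervals meet, the parameters 1 and 0 denote the same vertex, so any covering edge
    may be used. *)
Lemma phi_edge s x : 0 <= s <= W -> verts G x -> g x <= s <= g x + w x ->
  exists2 q, phi s = ComplexPt q &
    \val q = edge_pt x (succ x) ((s - g x) / w x).
Proof.
have consistent y z : verts G y -> verts G z -> lt y z ->
    g y <= s <= g y + w y -> g z <= s <= g z + w z ->
    edge_pt y (succ y) ((s - g y) / w y) = edge_pt z (succ z) ((s - g z) / w z).
  move=> Gy Gz yz sy sz.
  have [zE _ sE sE'] := position_overlap LO w0 mu1 muS muU Gy Gz yz sy sz.
  rewrite {1}sE' [g y + _]addrC addrK divff ?gt_eqF // sE subrr mul0r.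
  by rewrite edge_pt0 edge_pt1 zE.
move=> sW Gx sx; case: (phiP sW) => [[y [q [Gy sy -> qE]]]|[[_ /(_ x Gx)]//]].
exists q => //; rewrite qE; have [->//|yx] := eqVneq y x.
by case: (lim_total LO Gy Gx yx) => h; [|symmetry]; exact: consistent.
Qed.

Lemma phi_gap s : gap s -> exists r e,
  [/\ gap_ray s r, phi s = EndPt R e & \val e = end_of G r].
Proof.
by move=> [sW sg]; case: (phiP sW) => [[x [q [Gx /(sg x Gx)]]]|[]].
Qed.

Let W0 : 0 < W. Proof. exact: (total_length_gt0 LO Gv0 w0 mu1 muS muU). Qed.

Let pos_range x : verts G x -> 0 <= g x <= W.
Proof.
move=> Gx; rewrite (position_ge0 G lt muS muU) /=.
by have := position_le LO mu1 muS muU Gx; have := w0 x; lra.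
Qed.
Lemma phi_vertex x : verts G x -> exists2 q, phi (g x) = ComplexPt q &
  \val q = vertex_pt R x.
Proof.
move=> Gx; have [|q qE vE] := phi_edge (pos_range Gx) Gx.
  by rewrite lexx /=; have := w0 x; lra.
by exists q => //; rewrite vE subrr mul0r edge_pt0.
Qed.

(** The interval of the last vertex ends at [W], and its edge leads back to [v0]. *)
Lemma phi_closed : phi 0 = phi W.
Proof.
have [q] := phi_vertex Gv0; rewrite (position_root LO muU) => -> qE.
have [l Gl lE] := lim_pred LO Gv0; have lW := position_last LO mu1 muU Gl lE.
have [||q' -> q'E] := @phi_edge W l _ Gl.
- by rewrite lexx (ltW W0).
- by rewrite -lW lexx andbT; have := w0 l; lra.
congr ComplexPt; apply: val_inj.
rewrite -lW addrC addKr divff ?gt_eqF // edge_pt1 lE in q'E.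
by rewrite q'E.
Qed.

(** With parameter below 1 the starting vertex is in the support, so [x != y] would make each the
    successor of the other. *)
Lemma edge_pt_inj x y (t t' : R) : verts G x -> verts G y ->
  0 <= t < 1 -> 0 <= t' < 1 ->
  edge_pt x (succ x) t = edge_pt y (succ y) t' -> x = y /\ t = t'.
Proof.
move=> Gx Gy t01 t'01 E.
have nx := adj_neq (lim_adj LO Gx); have ny := adj_neq (lim_adj LO Gy).
have [xy|xy] := eqVneq x y.
  split=> //; move: (congr1 (fun f => f x) E).
  by rewrite edge_ptl // xy edge_ptl //; lra.
have : edge_pt y (succ y) t' x != 0 by rewrite -E edge_ptl //; apply/eqP; lra.
move=> /edge_ptN0[/eqP|xsy]; first by rewrite (negbTE xy).
have : edge_pt x (succ x) t y != 0 by rewrite E edge_ptl //; apply/eqP; lra.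
move=> /edge_ptN0[/eqP|ysx]; first by rewrite eq_sym (negbTE xy).
by have := lim_succ2 LO Gx; rewrite -ysx -xsy eqxx.
Qed.

Lemma phi_inj s s' : 0 <= s < W -> 0 <= s' < W -> phi s = phi s' -> s = s'.
Proof.
have le t : 0 <= t < W -> 0 <= t <= W by lra.
move=> sW s'W E; have [gs|ngs] := pselect (gap s).
  have [r [e [rs pE eE]]] := phi_gap gs.
  have [gs'|ngs'] := pselect (gap s').
    have [r' [e' [rs' pE' eE']]] := phi_gap gs'.
    have ee' : e = e' by move: E; rewrite pE pE' => -[].
    (* Equality of ends is equivalence in [G]; faithfulness carries it to [T], where rooted rays are
       then equal. *)
    have rr' : ray_equiv G r r'.
      apply: end_of_inj; first exact: gap_ray_G rs'.
      by rewrite -eE -eE' ee'.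
    have rE : r = r'.
      apply: (rooted_rays_equiv rT rs.1 rs'.1).
      by apply/(fT.2 _ _ (rooted_ray_ray rT rs.1) (rooted_ray_ray rT rs'.1)).
    rewrite -rE in rs'; have := gap_ray_inj gs gs' rs rs'.
    by have := gap_ray_inj gs' gs rs' rs; case: (ltgtP s s').
  have [x Gx sx] := not_gap_right LO w0 mu1 muU s'W ngs'.
  have [|q qE] := phi_edge (le _ s'W) Gx; first by lra.
  by move: E; rewrite pE qE.
have [x Gx sx] := not_gap_right LO w0 mu1 muU sW ngs.
have [|q qE vE] := phi_edge (le _ sW) Gx; first by lra.
have [gs'|ngs'] := pselect (gap s').
  by have [r' [e' [rs' pE' eE']]] := phi_gap gs'; move: E; rewrite pE' qE.
have [y Gy sy] := not_gap_right LO w0 mu1 muU s'W ngs'.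
have [|q' q'E v'E] := phi_edge (le _ s'W) Gy; first by lra.
have qq' : q = q' by move: E; rewrite qE q'E => -[].
have unit z t : g z <= t < g z + w z -> 0 <= (t - g z) / w z < 1.
  move=> tz; apply/andP; split; last by rewrite ltr_pdivrMr // mul1r; lra.
  by apply: divr_ge0; [lra|exact: ltW].
have [|xy] := edge_pt_inj Gx Gy (unit _ _ sx) (unit _ _ sy).
  by rewrite -vE -v'E qq'.
rewrite xy => /(divIf (lt0r_neq0 (w0 y))); lra.
Qed.

Lemma phi_near_edge s x (O : set (freudenthal R G)) : verts G x ->
  0 <= s <= W -> g x <= s <= g x + w x -> open O -> O (phi s) ->
  exists2 e, 0 < e & forall s', 0 <= s' <= W -> g x <= s' <= g x + w x ->
    `|s - s'| < e -> O (phi s').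
Proof.
move=> Gx sW sx [Oedge _] Os.
have /open_subspaceP[U oU UE] := Oedge _ _ (lim_adj LO Gx).
have UP t : 0 <= t <= 1 -> U t <-> edge_trace O x (succ x) t.
  move=> t01; have t01' : `[0, 1]%classic t by rewrite /= in_itv.
  split=> h.
    have : (U `&` `[0, 1]%classic) t by split.
    by rewrite UE => -[].
  have : (edge_trace O x (succ x) `&` `[0, 1]%classic) t by split.
  by rewrite -UE => -[].
have [q qE vE] := phi_edge sW Gx sx.
have Us : U ((s - g x) / w x).
  by apply/UP; [exact: unit_param|exists q; rewrite // -qE].
have /nbhs_ballP[e /= e0 eU] : nbhs ((s - g x) / w x) U.
  by apply: open_nbhs_nbhs; split.
exists (e * w x); first exact: mulr_gt0.
move=> s' s'W s'x ss'; have [q' q'E v'E] := phi_edge s'W Gx s'x.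
have : U ((s' - g x) / w x).
  apply: eU; rewrite /ball /= -mulrBl opprB addrA subrK normrM.
  by rewrite [`|_^-1|]gtr0_norm ?invr_gt0 // ltr_pdivrMr.
move=> /(UP _ (unit_param s'x))[p pE Op].
by rewrite q'E (_ : q' = p) //; apply: val_inj; rewrite v'E pE.
Qed.

(** Deep enough along the ray, an interval [D (r n)] misses [S] and thus lies in the component of
    the end; the open segment between its extreme vertices is the neighbourhood of [s]. *)
Lemma phi_near_gap s (O : set (freudenthal R G)) : gap s -> open O ->
  O (phi s) -> exists2 e, 0 < e & forall s', 0 <= s' <= W ->
    `|s - s'| < e -> O (phi s').
Proof.
move=> gs [_ Oend] Os; have [r [a [rs pE aE]]] := phi_gap gs.
rewrite pE in Os; have [S [fS SG SO]] := Oend _ Os.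
have aG : ends G (\val a) by exact: set_mem (valP a).
have [CS Ca] := end_comp_component fS SG aG.
have [N NS] := descendants_avoid rT fS.
have [rr _] := rs; have [n [Nn cD]] := convD rr N.
have DS : ~ (S `&` D (r n) !=set0).
  by move=> [x [Sx Dx]]; apply: (NS (r n) x) => //; rewrite (rooted_ray_level rT).
have DC x : D (r n) x -> end_comp G S (\val a) x.
  have [k kC] : has_tail (end_comp G S (\val a)) r.
    by apply: Ca; rewrite aE; split; [exact: gap_ray_G rs|
      apply: ray_equiv_refl; exact: gap_ray_G rs].
  have lnk u : D (r n) u -> linked (del_verts G S) (r n) u.
    exact: (descendants_linked TG rT DS).
  have Ck := kC _ (leq_maxl k n).
  have Dk : D (r n) (r (maxn k n)).
    by apply: (rooted_ray_descendants rT rr); exact: leq_maxr.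
  move=> /lnk rx; case: CS Ck => z Gz -> /= zk.
  exact: linked_trans zk (linked_trans (linked_sym (lnk _ Dk)) rx).
have [m [M [Dm DM ms DP]]] := gap_ray_interval gs rs cD.
exists (Num.min (s - g m) (g M - s)); first by rewrite lt_min; lra.
move=> s' s'W; rewrite lt_min !ltr_norml => ss'.
have {ss'} mM : g m < s' < g M by lra.
have MW := position_le LO mu1 muS muU (DG DM).
have wM := w0 M.
apply: SO; have [gs'|ngs'] := pselect (gap s').
  have [r' [b [rs' bE bE']]] := phi_gap gs'; rewrite bE /=.
  have bG : ends G (\val b) by exact: set_mem (valP b).
  have [CS' Cb] := end_comp_component fS SG bG.
  have [rr' r's] := rs'.
  (* Vertices just right of [s'] lie behind both [r n] and [r' n], which have the same level. *)
  have r'n : r' n = r n.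
    have [|x Dx xs] := r's n (g M - s'); first by lra.
    have Dx' : D (r n) x by apply/DP; [exact: DG Dx|lra].
    by apply: (descendants_level_inj rT Dx Dx'); rewrite !(rooted_ray_level rT).
  have [k kC] : has_tail (end_comp G S (\val b)) r'.
    by apply: Cb; rewrite bE'; split; [exact: gap_ray_G rs'|
      apply: ray_equiv_refl; exact: gap_ray_G rs'].
  apply: (components_meet CS' CS (kC _ (leq_maxl k n))).
  apply: DC; rewrite -r'n; apply: (rooted_ray_descendants rT rr').
  exact: leq_maxr.
(* The start [u] of the edge lies in [D (r n)], and the parameter below 1 makes its coordinate
   nonzero. *)
have [|u Gu us] := not_gap_right LO w0 mu1 muU (s := s') _ ngs'; first by lra.
have [|q qE vE] := phi_edge s'W Gu; first by lra.
rewrite qE; apply/(end_nbhd_complexE q fS SG aG); exists u.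
  apply/DC/DP => //; apply/andP; split; last by lra.
  rewrite leNgt; apply/negP => um.
  by have := position_lt LO mu1 muS muU Gu (cmp Gu (DG Dm) um); lra.
rewrite vE edge_ptl; last exact: adj_neq (lim_adj LO Gu).
rewrite subr_eq0 eq_sym; apply/negP => /eqP h.
by have := @divff _ (w u) (lt0r_neq0 (w0 u)); rewrite -h => /(divIf (lt0r_neq0 (w0 u))); lra.
Qed.

Lemma phi_near s (O : set (freudenthal R G)) : 0 <= s <= W -> open O ->
  O (phi s) -> exists2 e, 0 < e & forall s', 0 <= s' <= W ->
    `|s - s'| < e -> O (phi s').
Proof.
move=> sW oO Os; have [gs|ngs] := pselect (gap s); first exact: phi_near_gap.
have [e e0 eP] : exists2 e, 0 < e & forall s', 0 <= s' <= W -> s <= s' ->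
    `|s - s'| < e -> O (phi s').
  have [ltW_|geW] := ltP s W; last first.
    by exists 1 => // s' s'W ss' _; rewrite (_ : s' = s) //; lra.
  have [|x Gx sx] := not_gap_right LO w0 mu1 muU (s := s) _ ngs; first by lra.
  have [|e e0 eP] := phi_near_edge Gx sW _ oO Os; first by lra.
  exists (Num.min e (g x + w x - s)); first by rewrite lt_min e0; lra.
  move=> s' s'W ss'; rewrite lt_min => /andP[h1 h2]; apply: eP => //.
  by move: h2; rewrite ltr_norml; lra.
have [e' e'0 e'P] : exists2 e, 0 < e & forall s', 0 <= s' <= W -> s' <= s ->
    `|s - s'| < e -> O (phi s').
  have [gt0|le0] := ltP 0 s; last first.
    by exists 1 => // s' s'W ss' _; rewrite (_ : s' = s) //; lra.
  have [|x Gx sx] := not_gap_left LO w0 mu1 muU (s := s) _ ngs; first by lra.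
  have [|e'' e''0 eP''] := phi_near_edge Gx sW _ oO Os; first by lra.
  exists (Num.min e'' (s - g x)); first by rewrite lt_min e''0; lra.
  move=> s' s'W ss'; rewrite lt_min => /andP[h1 h2]; apply: eP'' => //.
  by move: h2; rewrite ltr_norml; lra.
exists (Num.min e e'); first by rewrite lt_min e0.
move=> s' s'W; rewrite lt_min => /andP[h1 h2].
by have [ss'|/ltW ss'] := leP s s'; [exact: eP|exact: e'P].
Qed.

Lemma phi_continuous : {within `[0, W], continuous phi}.
Proof.
apply/subspace_continuousP => s; rewrite /= in_itv /= => sW A.
rewrite nbhsE => -[B [oB Bs] BA].
have [e e0 eP] := phi_near sW oB Bs.
rewrite /fmap /= /within /= nbhs_simpl; apply/nbhs_ballP; exists e => //= s' ss'.
by rewrite in_itv /= => s'W; apply/BA/eP.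
Qed.

Lemma phi_hamiltonian : exists H : set (freudenthal R G), hamiltonian_circle H.
Proof.
have [e [ec eim e0W einj]] := unit_circle_param W0.
exists (phi @` `[0, W]); split; last first.
  move=> p v Gv pE; have [q qE vE] := phi_vertex Gv.
  exists (g v); first by rewrite /= in_itv /=; exact: pos_range.
  by rewrite qE; congr ComplexPt; apply: val_inj; rewrite vE pE.
rewrite -eim; apply: homeomorphic_of_compact.
- by exists 0; rewrite /= in_itv /= lexx (ltW W0).
- exact: segment_compact.
- exact: norm_hausdorff.
- exact: freudenthal_hausdorff.
- exact: continuous_subspaceT.
- exact: phi_continuous.
move=> s s'; rewrite /= !in_itv /= => sW s'W; split=> [|E].
  move=> /(einj _ _ sW s'W)[->//|/eqP].
  rewrite eqr_norml => /andP[/orP[]/eqP h _].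
    have -> : s = W by lra.
    have -> : s' = 0 by lra.
    exact/esym/phi_closed.
  have -> : s = 0 by lra.
  have -> : s' = W by lra.
  exact: phi_closed.
(* Folding [W] onto 0 reduces to the half-open segment, where [phi] is injective. *)
pose z t := if t == W then 0 else t.
have zP t : 0 <= t <= W -> [/\ 0 <= z t < W, phi (z t) = phi t & e (z t) = e t].
  move=> tW; rewrite /z; have [->|tnW] := eqVneq t W.
    by rewrite lexx W0 phi_closed.
  by split=> //; case/andP: tW => -> /=; rewrite lt_neqAle tnW.
have [z1 p1 <-] := zP _ sW; have [z2 p2 <-] := zP _ s'W.
by congr e; apply: phi_inj => //; rewrite p1 p2.
Qed.

End Circle.

(** As the levels exhaust [T], this makes the vertex set countable, as the weights require. *)
Lemma level_finite (V : choiceType) (G T : graph V) (v0 : V) (d : V -> nat)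
    (par : V -> V) (n : nat) :
  locally_finite G -> spanning T G -> rooted T v0 d par ->
  finite_set [set v | verts T v /\ d v = n].
Proof.
move=> lfG TG rT; elim: n => [|n IH].
  apply: sub_finite_set (finite_set1 v0) => v [Tv dv].
  exact: (level_eq0 rT).
apply: (@sub_finite_set _ _
  (\bigcup_(u in [set u | verts T u /\ d u = n]) [set v | adj G u v])).
  move=> v [Tv dv]; have v0' : v != v0.
    by apply/eqP => v0'; move: dv; rewrite v0' (rooted_level0 rT).
  exists (par v); last by apply: TG.1.2; exact: (rooted_adj_par rT).
  split; first exact: (par_verts rT).
  by have := rooted_levelS rT Tv v0'; rewrite dv => -[].
by apply: bigcup_finite => // u [Tu _]; apply: lfG; exact: TG.1.1.
Qed.

Theorem theorem3p14 (R : realType) (V : choiceType) (G T : graph V)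
    (F : set (set V))
    (hG : locally_finite G)
    (hT : is_tree T) (hTspan : spanning T G) (hTfaith : faithful T G)
    (hF : F `<=` edges T)
    (hFfin : forall D : set V, components (del_edges T F) D -> finite_set D)
    (hcyc : forall T' : graph V, subgraph T' T -> is_tree T' ->
       finite_set (verts T') ->
       exists C' : graph V,
         [/\ subgraph C' G, is_cycle C', verts T' `<=` verts C' &
             forall e : set V, (F `&` edges T') e -> crosses C' T e 2]) :
  exists H : set (freudenthal R G), hamiltonian_circle H.
Proof.
have [[v0 Tv0] _] := hT.1.
have [d [par rT]] := tree_rooted hT Tv0.
have Gv0 : verts G v0 by exact: hTspan.1.1.
have cntG : countable (verts G).
  rewrite -hTspan.2 (_ : verts T = \bigcup_n [set v | verts T v /\ d v = n]).
    apply: bigcup_countable => // n _; apply: finite_set_countable.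
    exact: level_finite hG hTspan rT.
  by apply/seteqP; split=> [v Tv|v [n _ []]] //; exists (d v).
have [w [mu [w0 mu1 muS muU mu_small]]] := countable_weights R cntG.
pose good v := [/\ verts T v, v != v0 & F [set par v; v]].
pose conv := [set descendants T par v | v in good].
(* Cycles are indexed by finite lists; the intersection discards entries that are no vertices of
   [T]. *)
have hc (s : seq V) := cycle_seq hTspan rT hT hcyc (S := [set` s] `&` verts T)
  (finite_setIl _ (finite_seq s)) (@subIsetr _ _ _).
have [c cP] := boolp.choice hc.
(* The tail filter of finite lists under inclusion: whatever holds once a given vertex is listed
   holds along [U]. *)
pose U0 : set_system (seq V) := [set A : set (seq V) | exists s : seq V,
  forall s' : seq V, {subset s <= s'} -> A s'].
have U0F : ProperFilter U0.
  apply: Build_ProperFilter_ex; first by move=> A [s sA]; exists s; exact: sA.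
  split.
  - by exists [::].
  - move=> A B [s sA] [s' s'B]; exists (s ++ s') => t st; split.
      by apply: sA => x xs; apply: st; rewrite mem_cat xs.
    by apply: s'B => x xs; apply: st; rewrite mem_cat xs orbT.
  - by move=> A B AB [s sA]; exists s => t /sA/AB.
have [U [UU U0U]] := ultraFilterLemma U0F.
have [lt [succ LO]] : exists lt succ, limit_order G v0 conv lt succ.
  apply: (ultra_limit_order (c := c) UU hG).
  - by move=> s; have [uc c3 cc _ [v0c v0i _]] := cP s.
  - move=> x Gx; apply: U0U; exists [:: x] => s xs.
    have [_ _ _ sc _] := cP s; apply: sc; split; first exact/xs/mem_head.
    by rewrite hTspan.2.
  - move=> _ [v [Tv v0' Fv] <-]; apply: U0U; exists [:: v] => s vs x y z zc.
    have [_ _ _ _ [_ _ sc]] := cP s; apply: sc v0' Fv zc; split=> //.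
    exact/vs/mem_head.
  move=> _ [v [Tv v0' Fv] <-]; split.
  - by move=> u [Tu _]; exact: hTspan.1.1.
  - by exists v; exact: descendants_refl.
  - exact: (descendants_notroot rT).
  - exact: (faithful_finite_cut hG hTspan rT).
(* A tail of the ray without edges of [F] would be an infinite subset of one component of
   [T - F]. *)
have convD r : rooted_ray T v0 par r ->
    forall N, exists n, (N <= n)%N /\ conv (descendants T par (r n)).
  move=> rr N; apply: contrapT => nN.
  have rN n : (N <= n)%N -> ~ F [set r n; r n.+1].
    move=> Nn Fn; apply: nN; exists n.+1; split; first exact: leqW.
    exists (r n.+1) => //; have [Tr r0 rp] := rr.2 n.
    by split=> //; rewrite rp.
  have [injr adjr] := rooted_ray_ray rT rr.
  have rNT n : adj (del_edges T F) (r (N + n)%N) (r (N + n).+1).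
    by rewrite /= adjr notin_setE; apply: rN; exact: leq_addr.
  have TrN : verts T (r N) by exact: (rooted_ray_verts rT).
  pose B := [set y | linked (del_edges T F) (r N) y].
  have BC : components (del_edges T F) B.
    by exists (r N).
  have rB n : B (r (N + n)%N).
    elim: n => [|n IH]; first by rewrite addn0; exact: linked_refl.
    apply: linked_trans IH _; split; first exact: adj_verts (rNT n).
    by exists [:: r (N + n).+1]; rewrite ?addnS //= andbT; exact: rNT.
  have [k kB] := ray_avoid (hFfin _ BC) injr.
  by apply: (kB (N + k)%N (leq_addl _ _)); exact: rB.
(* Outside the segment any value will do; the point at 0 supplies one, as choice needs a total
   function. *)
have hp s : exists p : freudenthal R G, 0 <= s <= total_length G mu ->
    circle_at T v0 par lt succ w mu s p.
  have [sW|nW] := pselect (0 <= s <= total_length G mu).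
    by have [p] := circle_at_exists hG hTspan rT LO w0 mu1 muS muU mu_small sW; exists p.
  have [p _] := circle_at_exists hG hTspan rT LO w0 mu1 muS muU mu_small
    (s := 0) (introT andP (conj (lexx 0) (mu_ge0 muS muU _))).
  by exists p.
have [phi phiP] := boolp.choice hp.
exact: (phi_hamiltonian hG hTspan hTfaith rT LO convD w0 mu1 muS muU mu_small phiP).
Qed.
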